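(* Let $I$ be a finite set, fix non-zero complex numbers $\beta_i$, $i\in I$, and let $\mathbb P$ be a Bernoulli measure on $\Omega=I^{\mathbb N}$. Then there exists a Borel set $\mathcal G\subset\Omega\times\mathbb D$ such that: (i) for $\mathbb P$-a.e. $\omega\in\Omega$, $\dim_H\{\lambda\in\mathbb D_*:(\omega,\lambda)\notin\mathcal G\}\le1$; (ii) if $(\omega,\lambda)\in\mathcal G$ and $\Sigma=((\Phi^{(i)})_{i\in I},(p_i)_{i\in I},\mathbb P)$ is any non-degenerate planar model with selection measure $\mathbb P$ such that the linear part of the maps in $\Phi^{(i)}$ is $\lambda^{\beta_i}$ with $|\lambda^{\beta_i}|<1$ for each $i$, then $\eta^{(\omega)}\in\mathcal D_2$.
   Context: $\mathbb D$ is the open unit disc, $\mathbb D_*=\mathbb D\setminus\{0\}$; $\lambda^\beta:=e^{\beta\log\lambda}$ with $\log$ the principal branch (imaginary part in $(-\pi,\pi]$). A planar model $\Sigma=((\Phi^{(i)})_{i\in I},(p_i)_{i\in I},\mathbb P)$: for each $i\in I$, $\Phi^{(i)}=(f^{(i)}_1,\dots,f^{(i)}_{k_i})$ with $f^{(i)}_j(z)=\lambda_i z+t^{(i)}_j$, $0<|\lambda_i|<1$; $p_i$ a probability vector with positive entries; $\mathbb P$ a probability on $\Omega=I^{\mathbb N}$. The random measure $\eta^{(\omega)}$ is the law of $\sum_{n\ge1}(\prod_{j=1}^{n-1}\lambda_{\omega_j})t^{(\omega_n)}_{u_n}$ with $u_n\in\{1,\dots,k_{\omega_n}\}$ independent with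 laws $p_{\omega_n}$. The model is non-degenerate if there is $i_0$ with $\mathbb P(\omega_1=i_0)>0$ and not all maps in $\Phi^{(i_0)}$ equal. Fourier transform $\widehat\mu(\xi)=\int e^{2\pi i\,\mathrm{Re}(z\bar\xi)}d\mu(z)$; $\mathcal D_2(\sigma)=\{\mu:|\widehat\mu(\xi)|=O_\mu(|\xi|^{-\sigma})\}$, $\mathcal D_2=\bigcup_{\sigma>0}\mathcal D_2(\sigma)$. *)

(* Defs.v *)
From HB Require Import structures.
From mathcomp Require Import all_boot all_order all_algebra.
From mathcomp Require Import all_classical all_reals all_analysis.
Set Implicit Arguments. Unset Strict Implicit. Unset Printing Implicit Defensive.
Import Order.TTheory GRing.Theory Num.Theory.
Import numFieldNormedType.Exports.
Local Open Scope classical_set_scope.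
Local Open Scope ring_scope.

(* Complex numbers are represented as pairs (Re, Im) in R * R, so that  *)
(* the plane carries the product Borel sigma-algebra (= Borel of R^2). *)
Section Complex.
Variable R : realType.
Definition cplx := (R * R)%type.
Definition cadd (z w : cplx) : cplx := (z.1 + w.1, z.2 + w.2).
Definition cmul (z w : cplx) : cplx :=
  (z.1 * w.1 - z.2 * w.2, z.1 * w.2 + z.2 * w.1).
Definition cnorm (z : cplx) : R := Num.sqrt (z.1 ^+ 2 + z.2 ^+ 2).
Definition cdist (z w : cplx) : R := cnorm (z.1 - w.1, z.2 - w.2).
(* principal argument, in (-pi, pi]  (half-angle formula; = pi on the
   negative real axis) *)
Definition carg (z : cplx) : R :=
  if (z.2 == 0) && (z.1 < 0) then pi
  else 2 * atan (z.2 / (cnorm z + z.1)).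
Definition clog (z : cplx) : cplx := (ln (cnorm z), carg z).
Definition cexp (z : cplx) : cplx := (expR z.1 * cos z.2, expR z.1 * sin z.2).
Definition cpow (lam beta : cplx) : cplx := cexp (cmul beta (clog lam)).
Definition disc : set cplx := [set z | cnorm z < 1].
Definition pdisc : set cplx := [set z | cnorm z < 1 /\ z != (0, 0)].
End Complex.

Section Hausdorff.
Variable R : realType.
Local Open Scope ereal_scope.
(* diameter, with the convention diam(empty) = 0 *)
Definition diam (E : set (cplx R)) : \bar R :=
  ereal_sup ([set 0] `|` [set (cdist x y)%:E | x in E & y in E]).
Definition epow (d : \bar R) (s : R) : \bar R :=
  if d is r%:E then (r `^ s)%:E else +oo.
Definition hausdorff_content (s delta : R) (A : set (cplx R)) : \bar R :=
  ereal_inf [set \sum_(0 <= n <oo) epow (diam (E n)) s | E in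
    [set E : nat -> set (cplx R) |
       A `<=` \bigcup_n E n /\ forall n, diam (E n) <= delta%:E]].
(* s-dimensional Hausdorff (outer) measure: limit (= sup) as delta -> 0+ *)
Definition hausdorff_measure (s : R) (A : set (cplx R)) : \bar R :=
  ereal_sup [set hausdorff_content s delta A | delta in [set d : R | (0 < d)%R]].
Definition hausdorff_dim (A : set (cplx R)) : \bar R :=
  ereal_inf [set s%:E | s in [set s : R | (0 <= s)%R /\ hausdorff_measure s A = 0]].
End Hausdorff.

Section Fourier.
Variable R : realType.
(* hat mu(xi) = int exp(2 pi i Re(z conj xi)) dmu(z);
   Re(z conj xi) = z.1 xi.1 + z.2 xi.2 *)
Definition fourier_re (mu : {measure set (cplx R) -> \bar R}) (xi : cplx R) : R :=
  Rintegral mu setT (fun z : cplx R => cos (2 * pi * (z.1 * xi.1 + z.2 * xi.2))).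
Definition fourier_im (mu : {measure set (cplx R) -> \bar R}) (xi : cplx R) : R :=
  Rintegral mu setT (fun z : cplx R => sin (2 * pi * (z.1 * xi.1 + z.2 * xi.2))).
Definition fourier_abs (mu : {measure set (cplx R) -> \bar R}) (xi : cplx R) : R :=
  cnorm (fourier_re mu xi, fourier_im mu xi).
Definition D2_sigma (mu : {measure set (cplx R) -> \bar R}) (sigma : R) : Prop :=
  exists C : R, forall xi : cplx R, 1 <= cnorm xi ->
    fourier_abs mu xi <= C * (cnorm xi) `^ (- sigma).
Definition D2 (mu : {measure set (cplx R) -> \bar R}) : Prop :=
  exists2 sigma : R, 0 < sigma & D2_sigma mu sigma.
End Fourier.

(* The symbolic space Omega = I^N with its cylinder (= Borel) sigma-algebra. *)
Definition Om (I : finType) (i0 : I) : Type := nat -> I.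
Section OmPointed.
Variables (I : finType) (i0 : I).
HB.instance Definition _ := Choice.copy (Om i0) (nat -> I).
HB.instance Definition _ := isPointed.Build (Om i0) (fun _ => i0).
End OmPointed.
(* the cylinder [w] = {omega | omega_1 ... omega_n = w}  (omega_1 = omega 0) *)
Definition cylinder (I : finType) (i0 : I) (w : seq I) : set (Om i0) :=
  [set om | [seq om j | j <- iota 0 (size w)] = w].
Arguments cylinder {I} i0 w.
Definition cylinders (I : finType) (i0 : I) : set (set (Om i0)) :=
  [set A | exists w : seq I, A = cylinder i0 w].
Arguments cylinders {I} i0.
Notation Omega i0 := (g_sigma_algebraType (cylinders i0)).

Definition bernoulli_measure (R : realType) (I : finType) (i0 : I)
    (q : I -> R) (P : probability (Omega i0) R) : Prop :=
  [/\ forall i, 0 <= q i, \sum_i q i = 1 &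
      forall w : seq I, P (cylinder i0 w) = (\prod_(i <- w) q i)%:E].

(* Planar models.  For each i : I, Phi^(i) = (f^(i)_j)_{j < k i}, with  *)
(* f^(i)_j(z) = lam i * z + t i j, and weights p i j (j < k i).          *)
Section Model.
Variables (R : realType) (I : finType).

Definition prob_vector (k : I -> nat) (p : I -> nat -> R) : Prop :=
  forall i, (forall j, (j < k i)%N -> 0 < p i j) /\
            \sum_(j < k i) p i j = 1.

Definition model_nondegenerate (i0 : I) (P : probability (Omega i0) R)
    (k : I -> nat) (t : I -> nat -> cplx R) : Prop :=
  exists i1 : I, (0 < P [set om : Omega i0 | om 0%N = i1])%E /\
    exists j1 j2, [/\ (j1 < k i1)%N, (j2 < k i1)%N & t i1 j1 <> t i1 j2].

Definition mutually_independent d d' (T : measurableType d) (T' : measurableType d')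
    (P : probability T R) (X : nat -> T -> T') : Prop :=
  forall (s : seq nat) (A : nat -> set T'), uniq s ->
    (forall n, measurable (A n)) ->
    P (\bigcap_(n in [set n | n \in s]) (X n @^-1` A n)) =
    (\prod_(n <- s) P (X n @^-1` A n))%E.

Fixpoint lin_prod (lam : I -> cplx R) (om : nat -> I) (n : nat) : cplx R :=
  if n is n'.+1 then cmul (lin_prod lam om n') (lam (om n')) else (1, 0).
Definition partial_sum (lam : I -> cplx R) (t : I -> nat -> cplx R)
    (om : nat -> I) (u : nat -> nat) (N : nat) : cplx R :=
  foldr (@cadd R) (0, 0)
    [seq cmul (lin_prod lam om n) (t (om n) (u n)) | n <- iota 0 N].
(* the (everywhere convergent) random series, as the limit of its partial sums *)
Definition random_sum (lam : I -> cplx R) (t : I -> nat -> cplx R)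
    (om : nat -> I) (u : nat -> nat) : cplx R :=
  (limn (fun N => (partial_sum lam t om u N).1),
   limn (fun N => (partial_sum lam t om u N).2)).

(* eta^(omega) is the law of the random sum, where the u_n are independent
   with laws p_{omega_n}; we state a property of eta^(omega) for every
   realisation (all realisations have the same law). *)
Definition eta_in_D2 (i0 : I) (om : Omega i0) (lam : I -> cplx R)
    (k : I -> nat) (t : I -> nat -> cplx R) (p : I -> nat -> R) : Prop :=
  forall d (T : measurableType d) (Q : probability T R) (u : nat -> T -> nat),
    (forall n, measurable_fun setT (u n)) ->
    (forall n j, (j < k (om n))%N -> Q (u n @^-1` [set j]) = (p (om n) j)%:E) ->
    mutually_independent Q u ->
    forall X : {mfun T >-> cplx R},
      (forall x, X x = random_sum lam t om (fun n => u n x)) ->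
      D2 (distribution Q X).
End Model.

(* Main.v *)
(** An Erdős-Kahane argument.  Write [l = log lam] and [S_n] for the sum of the
    first [n] exponents [beta], so that the [n]-th linear part is
    [Lam_n = exp (S_n l)].  The Fourier transform of [eta] at [xi] is a product
    over [n] of trigonometric sums; if [om_n = i] and [t_j1 <> t_j2] are
    translations of the system [i], the [n]-th factor is bounded away from [1] as
    soon as [Re (Lam_n w)], with [w = (t_j1 - t_j2) conj xi], is not close to an
    integer.  Hence it suffices that, for all large [w], a positive proportion of
    the times [n] with [om_n = i] and [|Lam_n w| >= 1] are of this kind.

    Four consecutive phases [Re (a^j x)], [j < 4], [a = exp (beta_i l)] non-real,
    determine [x] and [a] up to errors [O(h)] and [O(h / |x|)] when they are known
    up to [h], because [Re (a^j x)] satisfies a linear recurrence of order two.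
    Going from small scales up to [w], most blocks of times contain a run [iiii];
    if the corresponding phases are near the integers, these integers are
    determined by the previous step, so the number of possible [(l, w)] at
    resolution [exp (- c n)] grows only at a small exponential rate.  This covers
    the exceptional [l] with [exp (beta_i l)] non-real; the remaining ones lie on
    countably many curves, which accounts for the dimension [1].

    The set [G] is the complement of the limsup of these covers by boxes.  Each cover
    depends on finitely many letters of [om], so [G] is Borel without any
    projection argument. *)

Require Import Defs.
From HB Require Import structures.
From mathcomp Require Import all_boot all_order all_algebra.
From mathcomp Require Import all_classical all_reals all_analysis.
From mathcomp Require Import measurable_realfun ring lra zify.
Import Order.TTheory GRing.Theory Num.Theory.
Import numFieldNormedType.Exports.
Import Defs.
Local Open Scope classical_set_scope.
Local Open Scope ring_scope.
Set Implicit Arguments. Unset Strict Implicit. Unset Printing Implicit Defensive.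

(** * Complex numbers as pairs *)

Section ComplexArithmetic.
Context {R : realType}.
Implicit Types (z w u v x l : cplx R).

Definition csub z w : cplx R := (z.1 - w.1, z.2 - w.2).
Definition cconj z : cplx R := (z.1, - z.2).
Definition copp z : cplx R := (- z.1, - z.2).

Lemma cmulC z w : cmul z w = cmul w z.
Proof. by rewrite /cmul; congr pair; ring. Qed.

Lemma cmulA z w u : cmul z (cmul w u) = cmul (cmul z w) u.
Proof. by rewrite /cmul /=; congr pair; ring. Qed.

Lemma cmulBr z w u : cmul z (csub w u) = csub (cmul z w) (cmul z u).
Proof. by rewrite /cmul /csub /=; congr pair; ring. Qed.

Lemma cmulDl z w u : cmul (cadd w u) z = cadd (cmul w z) (cmul u z).
Proof. by rewrite /cmul /cadd /=; congr pair; ring. Qed.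

Lemma cmul1 z : cmul (1, 0) z = z.
Proof. by case: z => a b; rewrite /cmul /=; congr pair; ring. Qed.

Lemma cnorm_ge0 z : 0 <= cnorm z.
Proof. exact: sqrtr_ge0. Qed.

Lemma cnorm_sqr z : cnorm z ^+ 2 = z.1 ^+ 2 + z.2 ^+ 2.
Proof. by rewrite sqr_sqrtr// addr_ge0// sqr_ge0. Qed.

Lemma cnorm_le z c : 0 <= c -> (cnorm z <= c) = (z.1 ^+ 2 + z.2 ^+ 2 <= c ^+ 2).
Proof.
by move=> c0; rewrite -[LHS](ler_sqr (cnorm_ge0 z) c0) cnorm_sqr.
Qed.

Lemma cnormM z w : cnorm (cmul z w) = cnorm z * cnorm w.
Proof.
rewrite /cnorm -sqrtrM ?addr_ge0 ?sqr_ge0//; congr Num.sqrt.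
by rewrite /cmul /=; ring.
Qed.

Lemma ler_re_cnorm z : `|z.1| <= cnorm z.
Proof.
by rewrite /cnorm -sqrtr_sqr ler_wsqrtr// lerDl sqr_ge0.
Qed.

Lemma ler_im_cnorm z : `|z.2| <= cnorm z.
Proof.
by rewrite /cnorm -sqrtr_sqr ler_wsqrtr// lerDr sqr_ge0.
Qed.

Lemma cnorm_le_sum z : cnorm z <= `|z.1| + `|z.2|.
Proof.
rewrite cnorm_le ?addr_ge0// sqrrD !real_normK ?num_real//.
have := mulr_ge0 (normr_ge0 z.1) (normr_ge0 z.2); lra.
Qed.

Lemma cnormD z w : cnorm (cadd z w) <= cnorm z + cnorm w.
Proof.
rewrite cnorm_le ?addr_ge0 ?cnorm_ge0// [leRHS]sqrrD !cnorm_sqr /cadd /=.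
suff : z.1 * w.1 + z.2 * w.2 <= cnorm z * cnorm w by lra.
apply: le_trans (ler_norm _) _.
rewrite -cnormM; have -> : cnorm (cmul z w) = cnorm (cmul z (cconj w)).
  by rewrite !cnormM; congr (_ * _); rewrite /cnorm /cconj /= sqrrN.
apply: le_trans (ler_re_cnorm _).
by rewrite /cmul /cconj /= mulrN opprK.
Qed.

Lemma cnormN z : cnorm (copp z) = cnorm z.
Proof. by rewrite /cnorm /copp /= !sqrrN. Qed.

Lemma cnormB z w : cnorm (csub z w) <= cnorm z + cnorm w.
Proof. by rewrite -(cnormN w); exact: (cnormD z (copp w)). Qed.

Lemma cnorm_subC z w : cnorm (csub z w) = cnorm (csub w z).
Proof. by rewrite -cnormN /copp /csub /= !opprB. Qed.

Lemma cnorm0 : cnorm ((0, 0) : cplx R) = 0.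
Proof. by rewrite /cnorm /= expr0n addr0 sqrtr0. Qed.

Lemma cnorm1 : cnorm ((1, 0) : cplx R) = 1.
Proof. by rewrite /cnorm /= expr0n expr1n addr0 sqrtr1. Qed.

Lemma cnorm_eq0 z : (cnorm z == 0) = (z == (0, 0)).
Proof.
apply/idP/idP => [/eqP z0|/eqP ->]; last by rewrite cnorm0.
have := ler_re_cnorm z; have := ler_im_cnorm z.
by rewrite z0 !normr_le0; case: z {z0} => a b /= /eqP -> /eqP ->.
Qed.

Lemma cnorm_gt0 z : (0 < cnorm z) = (z != (0, 0)).
Proof. by rewrite lt_def cnorm_ge0 andbT cnorm_eq0. Qed.

Lemma cexpD u v : cexp (cadd u v) = cmul (cexp u) (cexp v).
Proof. by rewrite /cexp /cmul /cadd /= expRD cosD sinD; congr pair; ring. Qed.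

Lemma cexp0 : cexp ((0, 0) : cplx R) = (1, 0).
Proof. by rewrite /cexp /= expR0 cos0 sin0 mulr1 mulr0. Qed.

Lemma cnorm_cis t : cnorm ((cos t, sin t) : cplx R) = 1.
Proof. by rewrite /cnorm /= cos2Dsin2 sqrtr1. Qed.

Lemma cnorm_cexp u : cnorm (cexp u) = expR u.1.
Proof.
rewrite /cnorm /cexp /= !exprMn -mulrDr cos2Dsin2 mulr1 sqrtr_sqr.
by rewrite ger0_norm// expR_ge0.
Qed.

Lemma cnorm_cexp_le u : cnorm (cexp u) <= expR (cnorm u).
Proof.
by rewrite cnorm_cexp ler_expR (le_trans (ler_norm _))// ler_re_cnorm.
Qed.

(* The half-angle formula: with [u = y / (r + x)], [cos (2 atan u)] and
   [sin (2 atan u)] are [(1 - u^2) / (1 + u^2) = x / r] and [y / r]. *)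
Lemma clogK z : z != (0, 0) -> cexp (clog z) = z.
Proof.
move=> z0; have n0 : 0 < cnorm z by rewrite cnorm_gt0.
rewrite /cexp /clog /= lnK ?posrE// /carg.
case: ifPn => [/andP[/eqP z2 z1]|zneg].
  rewrite cospi sinpi mulr0 mulrN1; case: z z0 n0 z2 z1 => a b /= z0 n0 -> a0.
  by rewrite /cnorm /= expr0n addr0 sqrtr_sqr ltr0_norm// opprK.
have s0 : cnorm z + z.1 != 0.
  apply: contra zneg => /eqP s0.
  have z1 : z.1 = - cnorm z by lra.
  have := cnorm_sqr z; rewrite z1 sqrrN -[LHS]addr0 => /addrI/esym/eqP.
  by rewrite sqrf_eq0 => ->; rewrite oppr_lt0.
set u := z.2 / _.
have [/andP[a1 a2] tu] := atan_def u.
have c0 : cos (atan u) != 0 by rewrite gt_eqF// cos_gt0_pihalf// a1 a2.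
have su : sin (atan u) = u * cos (atan u) by rewrite -{2}tu /tan divfK.
have cu : (1 + u ^+ 2) * cos (atan u) ^+ 2 = 1.
  by rewrite -[RHS](cos2Dsin2 (atan u)) su; ring.
have hu : (1 + u ^+ 2) * (cnorm z + z.1) ^+ 2 = 2 * cnorm z * (cnorm z + z.1).
  have := cnorm_sqr z; set r := cnorm z => hr.
  rewrite mulrDl mul1r -exprMn /u divfK//.
  have -> : z.2 ^+ 2 = r ^+ 2 - z.1 ^+ 2 by rewrite hr; ring.
  by ring.
have u10 : 1 + u ^+ 2 != 0.
  by rewrite gt_eqF// ltr_wpDr ?sqr_ge0.
have hu' : (1 + u ^+ 2) * (cnorm z + z.1) = 2 * cnorm z.
  apply: (mulIf s0); rewrite -hu; ring.
have hc : 2 * cnorm z * cos (atan u) ^+ 2 = cnorm z + z.1.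
  by rewrite -hu' mulrAC cu mul1r.
rewrite mulr_natl cos_mulr2n sin_mulr2n su.
have -> : cnorm z * (cos (atan u) ^+ 2 *+ 2 - 1) = z.1.
  transitivity (2 * cnorm z * cos (atan u) ^+ 2 - cnorm z); first by ring.
  by rewrite hc; ring.
have -> : cnorm z * ((cos (atan u) * (u * cos (atan u))) *+ 2) = z.2.
  transitivity (u * (2 * cnorm z * cos (atan u) ^+ 2)); first by ring.
  by rewrite hc /u divfK.
by case: z {z0 n0 zneg s0 u a1 a2 tu c0 su cu hu u10 hu' hc}.
Qed.

End ComplexArithmetic.

(** * Lipschitz bounds and local inverse bounds for exp, sin and cos *)

Section ExponentialEstimates.
Context {R : realType}.
Implicit Types (a b t M : R) (u v : cplx R).

Lemma mvt_abs (f df : R -> R) a b M : (forall x : R, is_derive x (1 : R) f (df x)) ->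
  continuous f -> (forall x, `|df x| <= M) -> `|f b - f a| <= M * `|b - a|.
Proof.
move=> fd fc hM; wlog ab : a b / a <= b.
  move=> H; case: (leP a b) => [ab|/ltW ba]; first exact: H.
  by rewrite distrC (distrC b); apply: H.
have [c _ ->] := MVT_segment ab (fun x _ => fd x) (continuous_subspaceT fc).
by rewrite normrM ler_wpM2r.
Qed.

Lemma sin_lip a b : `|sin b - sin a| <= `|b - a|.
Proof.
rewrite -[leRHS]mul1r; apply: (mvt_abs (df := cos)) => [|x].
- exact: continuous_sin.
- exact: cos_max.
Qed.

Lemma cos_lip a b : `|cos b - cos a| <= `|b - a|.
Proof.
rewrite -[leRHS]mul1r; apply: (mvt_abs (df := fun x => - sin x)) => [|x].
- exact: continuous_cos.
- by rewrite normrN sin_max.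
Qed.

Lemma expR_lip a b M : a <= M -> b <= M -> `|expR b - expR a| <= expR M * `|b - a|.
Proof.
wlog ab : a b / a <= b.
  move=> H aM bM; case: (leP a b) => [ab|/ltW ba]; first exact: H.
  by rewrite distrC (distrC b); apply: H.
move=> aM bM.
have [c /andP[ac cb] ->] := MVT_segment ab (fun x _ => is_derive_expR x)
  (continuous_subspaceT (@continuous_expR R)).
rewrite !bnd_simp in ac cb.
by rewrite normrM ler_wpM2r// ger0_norm ?expR_ge0// ler_expR (le_trans cb).
Qed.

Lemma abs_sin_le t : `|sin t| <= `|t|.
Proof. by have := sin_lip 0 t; rewrite sin0 !subr0. Qed.

Lemma one_sub_cos_half t : 1 - cos t = 2 * sin (t / 2) ^+ 2.
Proof.
have -> : cos t = cos (t / 2 *+ 2) by congr cos; field.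
by rewrite cos_mulr2n sin2cos2; ring.
Qed.

Lemma one_sub_cos_le t : 1 - cos t <= t ^+ 2 / 2.
Proof.
rewrite one_sub_cos_half.
have : sin (t / 2) ^+ 2 <= (t / 2) ^+ 2.
  by rewrite -(real_normK (num_real (sin _))) -(real_normK (num_real (t / 2)))
    lerXn2r ?nnegrE// abs_sin_le.
have -> : (t / 2) ^+ 2 = t ^+ 2 / 4 by field.
lra.
Qed.

Lemma abs_sin_ge t : `|t| <= 1 -> `|t| / 2 <= `|sin t|.
Proof.
wlog t0 : t / 0 <= t.
  move=> H; case: (leP 0 t) => [/H//|tn] t1.
  by have := H (- t); rewrite sinN !normrN; apply => //; lra.
rewrite ger0_norm// => t1.
have [c /andP[ac cb] ] := MVT_segment t0 (fun x _ => is_derive_sin x)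
  (continuous_subspaceT (@continuous_sin R)).
rewrite !bnd_simp in ac cb; rewrite sin0 !subr0 => ->.
rewrite normrM (ger0_norm t0) mulrC ler_wpM2r//.
have := one_sub_cos_le c.
have : c ^+ 2 <= 1 by rewrite expr_le1//; lra.
by move=> h1 h2; rewrite ger0_norm; lra.
Qed.

Lemma one_sub_cos_ge t : `|t| <= 1 -> t ^+ 2 / 8 <= 1 - cos t.
Proof.
move=> t1; rewrite one_sub_cos_half.
have h : `|t / 2| <= 1 by rewrite normrM (@ger0_norm _ 2^-1)//; lra.
have := abs_sin_ge h; rewrite normrM (@ger0_norm _ 2^-1)// => h2.
have : (`|t| / 2 / 2) ^+ 2 <= sin (t / 2) ^+ 2.
  by rewrite -(real_normK (num_real (sin _))) lerXn2r ?nnegrE//; lra.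
rewrite !exprMn real_normK ?num_real//; lra.
Qed.

Lemma cexp_lip u v M : cnorm u <= M -> cnorm v <= M ->
  cnorm (csub (cexp u) (cexp v)) <= 3 * expR M * cnorm (csub u v).
Proof.
move=> uM vM.
have u1M : u.1 <= M by rewrite (le_trans _ uM)// (le_trans (ler_norm _))// ler_re_cnorm.
have v1M : v.1 <= M by rewrite (le_trans _ vM)// (le_trans (ler_norm _))// ler_re_cnorm.
(* The difference splits into a change of direction and a change of modulus. The first contributes 2
   to the constant 3, one each for cosine and sine; the second contributes 1. *)
have -> : csub (cexp u) (cexp v) =
    cadd (cmul (expR u.1, 0) (csub (cos u.2, sin u.2) (cos v.2, sin v.2)))
         (cmul (expR u.1 - expR v.1, 0) (cos v.2, sin v.2)).
  by rewrite /csub /cexp /cadd /cmul /=; congr pair; ring.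
rewrite (le_trans (cnormD _ _))// !cnormM cnorm_cis mulr1.
have e1 : cnorm ((expR u.1, 0) : cplx R) <= expR M.
  by rewrite (le_trans (cnorm_le_sum _))//= normr0 addr0 ger0_norm ?expR_ge0// ler_expR.
have e2 : cnorm (csub (cos u.2, sin u.2) (cos v.2, sin v.2)) <= 2 * cnorm (csub u v).
  rewrite (le_trans (cnorm_le_sum _))//= mulr_natl mulr2n lerD//.
    by rewrite (le_trans (cos_lip _ _))// (ler_im_cnorm (csub u v)).
  by rewrite (le_trans (sin_lip _ _))// (ler_im_cnorm (csub u v)).
have e3 : cnorm ((expR u.1 - expR v.1, 0) : cplx R) <= expR M * cnorm (csub u v).
  rewrite (le_trans (cnorm_le_sum _))//= normr0 addr0.
  rewrite (le_trans (expR_lip v1M u1M))// ler_wpM2l ?expR_ge0//.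
  exact: (ler_re_cnorm (csub u v)).
have := ler_pM (cnorm_ge0 _) (cnorm_ge0 _) e1 e2; lra.
Qed.

Lemma expR_sub1_ge t : `|t| <= 1 -> `|t| <= 2 * `|expR t - 1|.
Proof.
move=> t1; have e1 := expR_ge1Dx t; have e2 := expR_ge1Dx (- t).
have e3 := expRxMexpNx_1 t; have ep := expR_gt0 t.
case: (leP 0 t) t1 => t0; first by rewrite !ger0_norm//; lra.
move=> t1; have et : expR t < 1 by rewrite expR_lt1.
rewrite (ltr0_norm (x := expR t - 1)) ?subr_lt0//.
have : expR t * (1 - t) <= 1 by rewrite -[leRHS]e3 ler_pM2l.
move: t1; rewrite ltr0_norm// => t1 h.
have : 0 <= (2 + t - 2 * expR t) * (1 - t) by nra.
by rewrite pmulr_lge0; lra.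
Qed.

(** Comparing moduli bounds the real part with factor 2. The imaginary part of [cexp u] is
    [expR u.1 * sin u.2], where [expR u.1] is at least 1/4 and sine loses at most a factor 2, whence
    factor 8. *)
Lemma cexp_sub1_ge u : cnorm u <= 1 -> cnorm u <= 10 * cnorm (csub (cexp u) (1, 0)).
Proof.
move=> u1; set N := cnorm (csub _ _).
have a1 : `|u.1| <= 1 := le_trans (ler_re_cnorm u) u1.
have a2 : `|u.2| <= 1 := le_trans (ler_im_cnorm u) u1.
have N0 : 0 <= N by exact: cnorm_ge0.
have h1 : `|expR u.1 - 1| <= N.
  have := cnormB (csub (cexp u) (1, 0)) (copp (1, 0)).
  have := cnormB (csub (1, 0) (cexp u)) (copp (cexp u)).
  rewrite (cnorm_subC (1, 0)) -/N !cnormN cnorm1 cnorm_cexp.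
  have -> : csub (csub (1, 0) (cexp u)) (copp (cexp u)) = (1, 0).
    by rewrite /csub /copp /=; congr pair; ring.
  have -> : csub (csub (cexp u) (1, 0)) (copp (1, 0)) = cexp u.
    by rewrite [RHS]surjective_pairing /csub /copp /=; congr pair; ring.
  by rewrite cnorm1 cnorm_cexp => h2 h3; rewrite ler_norml; apply/andP; split; lra.
have h2 := expR_sub1_ge a1.
have h3 : expR u.1 * `|sin u.2| <= N.
  have := ler_im_cnorm (csub (cexp u) (1, 0)).
  by rewrite /= subr0 normrM ger0_norm ?expR_ge0.
have h4 := abs_sin_ge a2.
have h5 : 1 / 4 <= expR u.1.
  suff e4 : expR (1 : R) <= 4.
    have : 1 <= expR u.1 * expR 1.
      by rewrite -expRD (le_trans _ (expR_ge1Dx _))// lerDl; move: a1; rewrite ler_norml; lra.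
    by have := expR_ge0 u.1; nra.
  have e12 : expR (1 / 2 : R) <= 2.
    have := expR_ge1Dx (- (1 / 2) : R).
    have := expRxMexpNx_1 (1 / 2 : R); have := expR_gt0 (1 / 2 : R); nra.
  have -> : expR (1 : R) = expR (1 / 2) ^+ 2 by rewrite -expRM_natl; congr expR; lra.
  have : expR (1 / 2 : R) ^+ 2 <= 2 ^+ 2 by rewrite lerXn2r ?nnegrE ?expR_ge0.
  lra.
apply: le_trans (cnorm_le_sum _) _.
have : 1 / 4 * (`|u.2| / 2) <= N by rewrite (le_trans _ h3)// ler_pM//; lra.
lra.
Qed.

End ExponentialEstimates.

(** * Null sets for Hausdorff measures *)

Lemma powR_exprn {R : realType} (x s : R) n : 0 <= x ->
  (x `^ s) ^+ n = (x ^+ n) `^ s.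
Proof.
move=> x0; rewrite -(powR_mulrn n (powR_ge0 x s)) -(powR_mulrn n x0).
by rewrite -!powRrM mulrC.
Qed.

Section HausdorffNull.
Context {R : realType}.
Local Open Scope ereal_scope.
Implicit Types (A E : set (cplx R)) (s r : R).

(* The discrete sigma-algebra makes every set an admissible cover in [mu_ext]. *)
Definition all_sets_type := g_sigma_algebraType [set: set (cplx R)].

(** Hausdorff content with no restriction on the diameters. As an outer measure built by [mu_ext] it
    is monotone and countably subadditive, and its null sets are Hausdorff null when [s > 0]. *)
Definition content_inf s : set (cplx R) -> \bar R :=
  mu_ext (fun E : set all_sets_type => epow (diam (E : set (cplx R))) s).

Lemma diam_ge0 E : 0 <= diam E.
Proof. by apply: ereal_sup_ubound; left. Qed.

Lemma epow_ge0 (d : \bar R) s : 0 <= epow d s.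
Proof. by case: d => [r| |] //=; rewrite lee_fin powR_ge0. Qed.

Lemma diam_le E (r : R) : (0 <= r)%R ->
  (forall x y, E x -> E y -> (cdist x y <= r)%R) -> diam E <= r%:E.
Proof.
move=> r0 h; apply: ge_ereal_sup => _ [->|[x Ex [y Ey <-]]]; rewrite lee_fin//.
exact: h.
Qed.

Lemma epow_diam_le E (r s : R) : (0 <= r)%R -> (0 <= s)%R -> diam E <= r%:E ->
  epow (diam E) s <= (r `^ s)%:E.
Proof.
move=> r0 s0; have := diam_ge0 E; case: (diam E) => [d| |] //=.
by rewrite !lee_fin => d0 dr; rewrite ge0_ler_powR// nnegrE.
Qed.

Lemma epow_diam_set0 s : (0 < s)%R -> epow (diam (set0 : set (cplx R))) s = 0.
Proof.
move=> s0; apply/eqP; rewrite eq_le epow_ge0 andbT.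
have := @epow_diam_le set0 0 s (lexx _) (ltW s0); rewrite powR0 ?gt_eqF//.
by apply; apply: diam_le.
Qed.

Lemma nneseries_le (u : nat -> \bar R) c : (forall n, 0 <= u n) ->
  (forall n, \sum_(0 <= k < n) u k <= c) -> \sum_(0 <= k <oo) u k <= c.
Proof.
move=> u0 h; apply: lime_le; first exact: is_cvg_nneseries.
exact: nearW.
Qed.

Lemma content_inf_ge0 s A : 0 <= content_inf s A.
Proof. by apply: mu_ext_ge0 => E; exact: epow_ge0. Qed.

Lemma le_content_inf s A B : A `<=` B -> content_inf s A <= content_inf s B.
Proof. by move=> AB; exact: (@le_mu_ext _ all_sets_type R _ A B AB). Qed.

Lemma content_inf_sub s (A : nat -> set (cplx R)) :
  content_inf s (\bigcup_n A n) <= \sum_(0 <= n <oo) content_inf s (A n).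
Proof. by apply: mu_ext_sigma_subadditive => E; exact: epow_ge0. Qed.

Lemma content_inf_le_sum s (A : nat -> set (cplx R)) :
  content_inf s (\bigcup_n A n) <= \sum_(0 <= n <oo) epow (diam (A n)) s.
Proof.
apply: ereal_inf_lbound; exists A => //; split => // i.
exact: sub_sigma_algebra.
Qed.

Lemma content_inf_bigcup0 s (A : nat -> set (cplx R)) :
  (forall n, content_inf s (A n) = 0) -> content_inf s (\bigcup_n A n) = 0.
Proof.
move=> A0; apply/eqP; rewrite eq_le content_inf_ge0 andbT.
by rewrite (le_trans (content_inf_sub _ _))// eseries0.
Qed.

(** A cover whose sum of [s]-th powers is below [delta ^ s] has all its diameters below [delta], so
    a small sum makes the cover fine by itself. *)
Lemma hausdorff_measure_eq0 s A : (0 < s)%R ->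
  content_inf s A = 0 -> hausdorff_measure s A = 0.
Proof.
move=> s0 A0; apply/eqP; rewrite eq_le; apply/andP; split; last first.
  apply: le_ereal_sup_tmp; exists (hausdorff_content s 1 A); first by exists 1%R; [exact: ltr01|].
  apply: le_ereal_inf_tmp => _ [E _ <-]; apply: nneseries_ge0 => n _ _.
  exact: epow_ge0.
apply: ge_ereal_sup => _ [delta /= d0 <-].
apply/lee_addgt0Pr => e e0; rewrite add0e.
pose e' : R := Num.min e (delta `^ s)%R.
have e'0 : (0 < e')%R by rewrite lt_min e0 powR_gt0.
have : content_inf s A < e'%:E by rewrite A0 lte_fin.
move=> /ereal_inf_lt[_ [E [_ AE] <-]] sume.
apply: (@le_trans _ _ e'%:E); last by rewrite lee_fin ge_min lexx.
apply: (le_trans _ (ltW sume)); apply: ereal_inf_lbound; exists E => //.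
split => // n.
have : epow (diam (E n)) s < e'%:E.
  apply: le_lt_trans sume.
  apply: (le_trans _ (nneseries_lim_ge n.+1 _)); last by move=> *; exact: epow_ge0.
  rewrite big_nat_recr//= leeDr// sume_ge0// => *; exact: epow_ge0.
have := diam_ge0 (E n); case: (diam (E n)) => [r| |] //=.
rewrite !lee_fin lte_fin lt_min => r0 /andP[_ rd].
rewrite leNgt; apply/negP => dr.
by move: rd; rewrite ltNge ge0_ler_powR// ?nnegrE ?(ltW d0) ?(ltW s0) ?(ltW dr).
Qed.

Lemma hausdorff_dim_le1 A : (forall s, (1 < s)%R -> content_inf s A = 0) ->
  hausdorff_dim A <= 1%:E.
Proof.
move=> h; apply/lee_addgt0Pr => e e0.
apply: ereal_inf_lbound; exists (1 + e)%R => //; split; first by rewrite addr_ge0// ltW.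
by apply: hausdorff_measure_eq0; [rewrite addr_gt0|apply: h; rewrite ltrDl].
Qed.

Definition box (c : cplx R) (r : R) : set (cplx R) :=
  [set z | (`|z.1 - c.1| <= r)%R /\ (`|z.2 - c.2| <= r)%R].

Definition boxes (cs : seq (cplx R)) (r : R) : set (cplx R) :=
  [set z | exists2 c, c \in cs & box c r z].

Lemma content_inf_boxes (cs : seq (cplx R)) r s : (0 <= r)%R -> (0 < s)%R ->
  content_inf s (boxes cs r) <= ((size cs)%:R * (4 * r) `^ s)%:E.
Proof.
move=> r0 s0.
(* The list is padded by empty sets, which contribute nothing because [s > 0]. *)
pose E k := if (k < size cs)%N then box (nth (0, 0)%R cs k) r else set0.
apply: (@le_trans _ _ (content_inf s (\bigcup_k E k))).
  apply: le_content_inf => z [c ccs cz]; exists (index c cs) => //.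
  by rewrite /E index_mem ccs nth_index.
apply: (le_trans (content_inf_le_sum _ _)); apply: nneseries_le => [n|n].
  exact: epow_ge0.
apply: (@le_trans _ _ ((minn n (size cs))%:R * (4 * r) `^ s)%:E); last first.
  by rewrite lee_fin ler_wpM2r ?powR_ge0// ler_nat geq_minr.
elim: n => [|n IH]; first by rewrite big_nil min0n mul0r.
rewrite big_nat_recr//=; rewrite {2}/E.
case: ltnP => hn.
  rewrite (minn_idPl hn) -natr1 mulrDl mul1r EFinD; apply: leeD.
    by rewrite (minn_idPl (ltnW hn)) in IH.
  apply: epow_diam_le; [by rewrite mulr_ge0|exact: ltW|].
  apply: diam_le => [|x y [x1 x2] [y1 y2]]; first by rewrite mulr_ge0.
  rewrite (le_trans (cnorm_le_sum _))//=.
  move: x1 x2 y1 y2; rewrite !ler_norml => /andP[? ?] /andP[? ?] /andP[? ?] /andP[? ?].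
  have : (`|x.1 - y.1| <= 2 * r)%R by rewrite ler_norml; lra.
  have : (`|x.2 - y.2| <= 2 * r)%R by rewrite ler_norml; lra.
  lra.
by rewrite epow_diam_set0// adde0 (minn_idPr (leqW hn)); rewrite (minn_idPr hn) in IH.
Qed.

(** Borel-Cantelli for contents: [N_M] boxes of radius [r_M] cost [N_M (4 r_M)^s], that is
    [4^s (N_M r_M) r_M^(s-1)]. The middle factor is bounded and the last decays geometrically for
    [s > 1], so the tails of the sum tend to 0. *)
Lemma content_inf_limsup0 (cs : nat -> seq (cplx R)) (r : nat -> R) (C s : R) N :
  (1 < s)%R -> (0 < C)%R ->
  (forall M, (N <= M)%N -> [/\ 0 <= r M, r M <= C * 2^-1 ^+ M &
     (size (cs M))%:R * r M <= C]%R) ->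
  content_inf s (\bigcap_n \bigcup_(M in [set M | (n <= M)%N]) boxes (cs M) (r M)) = 0.
Proof.
move=> s1 C0 h; set A := (X in content_inf s X).
have s0 : (0 < s)%R by rewrite (lt_trans _ s1).
pose rho : R := (2^-1 `^ (s - 1))%R.
have rho0 : (0 < rho)%R by rewrite powR_gt0.
have rho1 : (rho < 1)%R.
  have : (ln rho < 0)%R.
    by rewrite ln_powR pmulr_rlt0 ?subr_gt0// ln_lt0//; lra.
  by rewrite -expR_lt1 lnK.
pose D : R := (4 `^ s * C * C `^ (s - 1))%R.
have D0 : (0 < D)%R by rewrite !mulr_gt0// powR_gt0.
have term M : (N <= M)%N ->
    content_inf s (boxes (cs M) (r M)) <= (D * rho ^+ M)%:E.
  move=> /h[r0 rC nr]; apply: (le_trans (content_inf_boxes _ r0 s0)).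
  rewrite lee_fin powRM// -(mulr_powRB1 r0 s0).
  have : (r M `^ (s - 1) <= C `^ (s - 1) * rho ^+ M)%R.
    have -> : (C `^ (s - 1) * rho ^+ M = (C * 2^-1 ^+ M) `^ (s - 1))%R.
      rewrite powRM ?exprn_ge0 ?(ltW C0)//; congr (_ * _)%R.
      by rewrite /rho powR_exprn.
    by rewrite ge0_ler_powR ?nnegrE ?subr_ge0 ?(ltW s1)// mulr_ge0 ?ltW// exprn_gt0.
  move=> hr.
  have := ler_pM (mulr_ge0 (ler0n _ _) r0) (powR_ge0 _ _) nr hr.
  have := powR_gt0 s (ltr0n R 4); rewrite /D.
  set a := (4 `^ s)%R; set b := (r M `^ _)%R; set c := (C `^ _)%R.
  move=> a0 hh; have := ler_wpM2l (ltW a0) hh.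
  by rewrite (_ : a * (_%:R * _ * b) = (size (cs M))%:R * (a * (r M * b)))%R; [|ring];
    rewrite (_ : a * (C * (c * _)) = a * C * c * rho ^+ M)%R; [|ring].
apply/eqP; rewrite eq_le content_inf_ge0 andbT.
have tail n : (N <= n)%N -> content_inf s A <= (D / (1 - rho) * rho ^+ n)%:E.
  move=> Nn.
  apply: (@le_trans _ _ (content_inf s (\bigcup_k boxes (cs (n + k)%N) (r (n + k)%N)))).
    apply: le_content_inf => z /(_ n I)[M /= nM zM].
    by exists (M - n)%N => //; rewrite subnKC.
  apply: (le_trans (content_inf_sub _ _)); apply: nneseries_le => [k|k].
    exact: content_inf_ge0.
  apply: (@le_trans _ _ (\sum_(0 <= i < k) (D * rho ^+ n * rho ^+ i)%:E)).
    apply: lee_sum => i _.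
    by rewrite -mulrA -exprD; apply: term; rewrite (leq_trans Nn)// leq_addr.
  rewrite sumEFin lee_fin.
  have := @geometric_le_lim R k (D * rho ^+ n)%R rho.
  rewrite /series/= /geometric/= (_ : D / (1 - rho) * _ = D * rho ^+ n / (1 - rho))%R; last by ring.
  apply => //; first by rewrite mulr_ge0 ?exprn_ge0 ?ltW.
  by rewrite ger0_norm ?ltW.
apply/lee_addgt0Pr => e e0; rewrite add0e.
have [n Nn hn] : exists2 n, (N <= n)%N & (D / (1 - rho) * rho ^+ n <= e)%R.
  have : (fun n => D / (1 - rho) * rho ^+ n)%R @ \oo --> (0 : R)%R.
    by apply: cvg_geometric; rewrite ger0_norm ?ltW.
  move=> /cvgrPdist_le /(_ e e0) [n0 _ hn0]; exists (maxn N n0); first exact: leq_maxl.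
  have := hn0 (maxn N n0) (leq_maxr _ _).
  by rewrite /= sub0r normrN => /(le_trans (ler_norm _)).
by rewrite (le_trans (tail n Nn))// lee_fin.
Qed.

End HausdorffNull.

(** * Bernoulli measures *)

Section WordExpectation.
Context {R : realType} {I : finType} (q : I -> R).
Hypotheses (q_ge0 : forall i, 0 <= q i) (q_sum1 : \sum_i q i = 1).

(** Expectation of [F] over [n] independent letters of law [q]. The recursive form reduces the large
    deviation estimate to algebra; [probability_prefix_le] transfers it to the measure. *)
Fixpoint word_exp (n : nat) (F : seq I -> R) : R :=
  if n is n'.+1 then \sum_a q a * word_exp n' (fun v => F (a :: v)) else F [::].

Lemma word_exp_cat n m F :
  word_exp (n + m) F = word_exp n (fun u => word_exp m (fun v => F (u ++ v))).
Proof. by elim: n F => //= n IH F; apply: eq_bigr => a _; rewrite IH. Qed.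

Lemma le_word_exp n F G : (forall v, size v = n -> F v <= G v) ->
  word_exp n F <= word_exp n G.
Proof.
elim: n F G => [F G h|n IH F G h] /=; first exact: h.
apply: ler_sum => a _; rewrite ler_wpM2l//; apply: IH => v sv.
by apply: h; rewrite /= sv.
Qed.

Lemma eq_word_exp n F G : (forall v, size v = n -> F v = G v) ->
  word_exp n F = word_exp n G.
Proof.
by move=> h; apply/eqP; rewrite eq_le !le_word_exp// => v /h ->.
Qed.

Lemma word_expZ n c F : word_exp n (fun v => c * F v) = c * word_exp n F.
Proof.
elim: n F => //= n IH F; rewrite mulr_sumr; apply: eq_bigr => a _.
by rewrite IH mulrCA.
Qed.

Lemma word_expD n F G :
  word_exp n (fun v => F v + G v) = word_exp n F + word_exp n G.
Proof.
elim: n F G => //= n IH F G; rewrite -big_split; apply: eq_bigr => a _ /=.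
by rewrite IH mulrDr.
Qed.

Lemma word_exp_cst n c : word_exp n (fun=> c) = c.
Proof. by elim: n => //= n ->; rewrite -mulr_suml q_sum1 mul1r. Qed.

Lemma word_exp_nseq n i : word_exp n (fun v => (v == nseq n i)%:R) = q i ^+ n.
Proof.
elim: n => [|n IH] /=; first by rewrite expr0.
rewrite (bigD1 i)//= big1 ?addr0 => [|a ai].
  rewrite exprS -IH; congr (_ * _); apply: eq_word_exp => v _.
  by rewrite eqseq_cons eqxx.
rewrite (@eq_word_exp _ _ (fun=> 0)) ?word_exp_cst ?mulr0// => v _.
by rewrite eqseq_cons (negbTE ai).
Qed.

(** Only runs starting at multiples of 4 are looked for: these events are independent, so the
    probability of finding none is exactly a power. *)
Fixpoint no_run4 (i : I) (n : nat) (w : seq I) : bool :=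
  if n is n'.+1 then (take 4 w != nseq 4 i) && no_run4 i n' (drop 4 w) else true.

Lemma word_exp_no_run4 i n :
  word_exp (4 * n) (fun w => (no_run4 i n w)%:R) = (1 - q i ^+ 4) ^+ n.
Proof.
elim: n => [|n IH]; first by rewrite muln0.
rewrite mulnS word_exp_cat exprS -IH.
rewrite (@eq_word_exp _ _ (fun u => word_exp (4 * n) (fun w => (no_run4 i n w)%:R)
   * (1 + (-1) * (u == nseq 4 i)%:R))).
  by rewrite word_expZ word_expD word_expZ word_exp_cst word_exp_nseq mulN1r mulrC.
move=> u su; rewrite mulrC -word_expZ; apply: eq_word_exp => v sv.
by rewrite /= take_size_cat// drop_size_cat//; case: eqP; case: no_run4 => _ /=; ring.
Qed.

Fixpoint count_blocks (bad : pred (seq I)) (L M : nat) (w : seq I) : nat :=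
  if M is M'.+1 then (bad (take L w) + count_blocks bad L M' (drop L w))%N else 0%N.

(** Disjoint blocks are independent, so the generating function of the count factorises. *)
Lemma word_exp_count_blocks (bad : pred (seq I)) L M theta :
  word_exp (L * M) (fun w => theta ^+ count_blocks bad L M w) =
  (1 + (theta - 1) * word_exp L (fun w => (bad w)%:R)) ^+ M.
Proof.
elim: M => [|M IH]; first by rewrite muln0.
rewrite mulnS word_exp_cat exprS -IH.
rewrite (@eq_word_exp _ _ (fun u =>
   word_exp (L * M) (fun w => theta ^+ count_blocks bad L M w)
   * (1 + (theta - 1) * (bad u)%:R))).
  by rewrite word_expZ word_expD word_expZ word_exp_cst mulrC.
move=> u su; rewrite mulrC -word_expZ; apply: eq_word_exp => v sv.
rewrite /= take_size_cat// drop_size_cat// exprD; congr (_ * _).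
by case: (bad u) => /=; rewrite ?expr1 ?expr0; ring.
Qed.

(* Chernoff bound with parameter [4 ^ D]. *)
Lemma word_exp_many_blocks (bad : pred (seq I)) L M D :
  4 ^+ D * word_exp L (fun w => (bad w)%:R) <= 1 ->
  word_exp (L * M) (fun w => (M <= D * count_blocks bad L M w)%N%:R) <= 2^-1 ^+ M.
Proof.
move=> h; set tau := word_exp _ _ in h.
have tau0 : 0 <= tau.
  by rewrite /tau -(word_exp_cst L 0); apply: le_word_exp => v _.
have t1 : 1 <= (4 : R) ^+ D by rewrite exprn_ege1// ler1n.
apply: (@le_trans _ _ (word_exp (L * M)
    (fun w => 4^-1 ^+ M * (4 ^+ D) ^+ count_blocks bad L M w))).
  apply: le_word_exp => v _; case: leqP => h1 /=; last first.
    by rewrite mulr_ge0// exprn_ge0.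
  rewrite -exprM exprVn mulrC ler_pdivlMr ?exprn_gt0// mul1r.
  by rewrite ler_weXn2l// ler1n.
rewrite word_expZ word_exp_count_blocks -exprMn lerXn2r ?nnegrE//.
  by rewrite mulr_ge0// addr_ge0// mulr_ge0// subr_ge0.
by rewrite -/tau; nra.
Qed.

End WordExpectation.

Section BernoulliCylinders.
Context {R : realType} {I : finType} {i0 : I}.
Implicit Types (om : Omega i0) (u w : seq I).

Definition prefix_word (om : nat -> I) (n : nat) : seq I := [seq om j | j <- iota 0 n].

Lemma size_prefix_word om n : size (prefix_word om n) = n.
Proof. by rewrite size_map size_iota. Qed.

Lemma measurable_cylinder w : measurable (cylinder i0 w : set (Omega i0)).
Proof. by apply: sub_sigma_algebra; exists w. Qed.

Lemma cylinderE w om : cylinder i0 w om = (prefix_word om (size w) = w).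
Proof. by []. Qed.

Lemma measurable_prefix (A : set (seq I)) n :
  measurable [set om : Omega i0 | A (prefix_word om n)].
Proof.
rewrite (_ : [set _ | _] = \bigcup_(t in [set t : n.-tuple I | A t])
    (cylinder i0 t : set (Omega i0))).
  apply: fin_bigcup_measurable => // t _; exact: measurable_cylinder.
apply/seteqP; split => [om /= Aom|om /= [t At]].
  have sz : size (prefix_word om n) == n by rewrite size_prefix_word.
  exists (Tuple sz) => //=; rewrite cylinderE /= size_prefix_word.
  exact: erefl.
by rewrite cylinderE size_tuple => ->.
Qed.

(** The cylinder is extended one letter at a time. An upper bound suffices for Borel-Cantelli and
    uses subadditivity alone. *)
Lemma probability_prefix_le (q : I -> R) (P : probability (Omega i0) R)
    (A : pred (seq I)) n u : bernoulli_measure q P ->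
  (P [set om : Omega i0 | cylinder i0 u om /\ A (prefix_word om (size u + n))] <=
   (\prod_(i <- u) q i * word_exp q n (fun v => (A (u ++ v))%:R))%:E)%E.
Proof.
move=> hP; have [q0 q1 hq] := hP.
have mA v k : measurable [set om : Omega i0 |
    cylinder i0 v om /\ A (prefix_word om k)].
  apply: (@measurableI _ _ (cylinder i0 v : set (Omega i0))
    [set om | A (prefix_word om k)]); first exact: measurable_cylinder.
  exact: (measurable_prefix (fun w => A w)).
elim: n u => [|n IH] u.
  rewrite /= cats0; case Au : (A u); last first.
    rewrite (_ : [set _ | _] = set0) ?measure0 ?mulr0//.
    rewrite -subset0 => om /= []; rewrite cylinderE addn0 => ->.
    by rewrite Au.
  rewrite mulr1 -hq le_measure ?inE//; first exact: measurable_cylinder.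
  by move=> om [].
have step : [set om : Omega i0 | cylinder i0 u om /\ A (prefix_word om (size u + n.+1))]
   `<=` \bigcup_(a in [set` index_enum I]) [set om : Omega i0 | cylinder i0 (rcons u a) om /\
     A (prefix_word om (size (rcons u a) + n))].
  move=> om /= [uom Aom]; exists (om (size u)) => /=; first exact: mem_index_enum.
  rewrite size_rcons addSnnS; split => //; rewrite cylinderE in uom.
  rewrite cylinderE size_rcons /prefix_word -addn1 iotaD map_cat /= cats1.
  by rewrite -/(prefix_word om (size u)) uom.
apply: (le_trans (@content_sub_fsum _ _ _ P _ _ _ _ (finite_seq _)
  (fun a _ => mA (rcons u a) _) (mA u _) step)).
rewrite -fsbig_seq ?index_enum_uniq//= mulr_sumr -sumEFin; apply: lee_sum => a _.
apply: (le_trans (IH _)); rewrite lee_fin -cats1 big_cat big_seq1 /= mulrA.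
rewrite (@eq_word_exp _ _ _ q0 _ _ (fun v => (A (u ++ a :: v))%:R))// => v _.
by rewrite -catA.
Qed.

(** A block of length [4 * (e * D)] has no aligned run with probability at most [4 ^ - D], which is
    what the Chernoff bound asks for. The exceptional events then have probability at most
    [2 ^ - M], and Borel-Cantelli applies. *)
Lemma ae_few_blocks (q : I -> R) (P : probability (Omega i0) R) (i : I) (e D : nat) :
  bernoulli_measure q P -> (1 - q i ^+ 4) ^+ e <= 4^-1 ->
  {ae P, forall om : Omega i0, exists N, forall M, (N <= M)%N ->
    (D * count_blocks (no_run4 i (e * D)) (4 * (e * D)) M
           (prefix_word om (4 * (e * D) * M)) < M)%N}.
Proof.
move=> hP he; have [q0 q1 hq] := hP.
have qi1 : q i <= 1 by rewrite -q1 (bigD1 i)//= lerDl sumr_ge0.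
set L := (4 * (e * D))%N.
pose cnt M := count_blocks (no_run4 i (e * D)) L M.
pose F M := [set om : Omega i0 | (M <= D * cnt M (prefix_word om (L * M)))%N].
have mF M : measurable (F M).
  exact: (measurable_prefix (fun w => (M <= D * cnt M w)%N)).
have PF M : (P (F M) <= (2^-1 ^+ M)%:E)%E.
  have -> : F M = [set om : Omega i0 | cylinder i0 [::] om /\
      (fun w => (M <= D * cnt M w)%N) (prefix_word om (size ([::] : seq I) + L * M))].
    by apply/seteqP; split => om //= [].
  apply: (le_trans (@probability_prefix_le q P (fun w => (M <= D * cnt M w)%N) (L * M) [::] hP)).
  rewrite lee_fin big_nil mul1r; apply: word_exp_many_blocks => //.
  rewrite word_exp_no_run4// exprM -exprMn.
  rewrite exprn_ile1//; first by rewrite mulr_ge0// exprn_ge0// subr_ge0 exprn_ile1.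
  lra.
exists (lim_sup_set F); split.
- by apply: bigcap_measurable => // k _; apply: bigcup_measurable => *; exact: mF.
- apply: lim_sup_set_cvg0 => //; apply: (@le_lt_trans _ _ 2%:E); last by rewrite ltry.
  apply: nneseries_le => [n|n]; first exact: measure_ge0.
  apply: (@le_trans _ _ (\sum_(0 <= k < n) (2^-1 ^+ k)%:E)%E).
    by apply: lee_sum => k _; exact: PF.
  rewrite sumEFin lee_fin.
  have := @geometric_le_lim R n 1 2^-1 ler01.
  rewrite /series/= /geometric/= ger0_norm// (_ : 1 / (1 - 2^-1) = 2); last by field.
  under eq_bigr do rewrite mul1r.
  by apply; lra.
move=> om /= h k _; apply: contrapT => h2; apply: h; exists k => M kM.
by rewrite ltnNge; apply/negP => h3; apply: h2; exists M.
Qed.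

End BernoulliCylinders.

(** * Rigidity of four consecutive phases *)

Section Rigidity.
Context {R : realType}.
Implicit Types (x a l v : cplx R) (h H sg m : R).

(* [P(z) = (z - a)(z - conj a)] has real coefficients and annihilates the
   sequence [Re (a^j x)]; hence [Re (x' P(a'))] and [Re (x' a' P(a'))] are small. *)
Lemma four_values_rigid x x' a a' sg h : 0 < sg -> sg <= 1 -> 0 <= h ->
  cnorm a <= 1 -> cnorm a' <= 1 -> sg <= `|a.2| -> sg <= `|a'.2| ->
  cnorm (csub a a') <= sg ->
  `|x.1 - x'.1| <= h -> `|(cmul a x).1 - (cmul a' x').1| <= h ->
  `|(cmul a (cmul a x)).1 - (cmul a' (cmul a' x')).1| <= h ->
  `|(cmul a (cmul a (cmul a x))).1 - (cmul a' (cmul a' (cmul a' x'))).1| <= h ->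
  cnorm x' * cnorm (csub a a') <= 12 * h / sg ^+ 2 /\
  cnorm (csub x x') <= 15 * h / sg ^+ 3.
Proof.
move=> sg0 sg1 h0 a1 a1' sa sa' aa' e0 e1 e2 e3.
set Y0 := x.1 - x'.1 in e0; set Y1 := _ - _ in e1.
set Y2 := _ - _ in e2; set Y3 := _ - _ in e3.
have ra : `|a.1| <= 1 := le_trans (ler_re_cnorm a) a1.
have ra' : `|a'.1| <= 1 := le_trans (ler_re_cnorm a') a1'.
have na : a.1 ^+ 2 + a.2 ^+ 2 <= 1 by rewrite -cnorm_sqr expr_le1// cnorm_ge0.
have nb U V W : `|U| <= h -> `|V| <= h -> `|W| <= h ->
    `|U - 2 * a.1 * V + (a.1 ^+ 2 + a.2 ^+ 2) * W| <= 4 * h.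
  move=> hU hV hW.
  have t1 : `|2 * a.1 * V| <= 2 * h.
    by rewrite !normrM (@ger0_norm _ 2)// -mulrA ler_pM2l// -[leRHS]mul1r ler_pM.
  have t2 : `|(a.1 ^+ 2 + a.2 ^+ 2) * W| <= h.
    have p0 : 0 <= a.1 ^+ 2 + a.2 ^+ 2 by rewrite addr_ge0 ?sqr_ge0.
    by rewrite normrM (ger0_norm p0) -[leRHS]mul1r ler_pM.
  have := ler_normD (U - 2 * a.1 * V) ((a.1 ^+ 2 + a.2 ^+ 2) * W).
  have := ler_normB U (2 * a.1 * V); lra.
pose z := cmul x' (cmul (csub a' a) (csub a' (cconj a))).
have z1 : `|z.1| <= 4 * h.
  rewrite (_ : z.1 = - (Y2 - 2 * a.1 * Y1 + (a.1 ^+ 2 + a.2 ^+ 2) * Y0)).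
    by rewrite normrN; exact: nb.
  by rewrite /z /Y2 /Y1 /Y0 /cmul /csub /cconj /=; ring.
have az1 : `|(cmul a' z).1| <= 4 * h.
  rewrite (_ : (cmul a' z).1 = - (Y3 - 2 * a.1 * Y2 + (a.1 ^+ 2 + a.2 ^+ 2) * Y1)).
    by rewrite normrN; exact: nb.
  by rewrite /z /Y3 /Y2 /Y1 /cmul /csub /cconj /=; ring.
have sgV : 1 <= sg^-1 by rewrite -[leLHS]invr1 lef_pV2 ?posrE.
(* The real parts of [z] and of [a' z] determine the imaginary part of [z], at the cost of dividing
   by [|a'.2|]. *)
have z2 : `|z.2| <= 8 * h / sg.
  rewrite ler_pdivlMr// mulrC.
  apply: (@le_trans _ _ (`|a'.2| * `|z.2|)); first by rewrite ler_wpM2r.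
  rewrite -normrM (_ : a'.2 * z.2 = a'.1 * z.1 - (cmul a' z).1); last first.
    by rewrite /cmul /=; ring.
  have := ler_normB (a'.1 * z.1) (cmul a' z).1.
  have : `|a'.1 * z.1| <= 4 * h by rewrite normrM -[leRHS]mul1r ler_pM.
  lra.
have nz : cnorm z <= 12 * h / sg.
  rewrite (le_trans (cnorm_le_sum z))//.
  have : 4 * h <= 4 * h / sg by rewrite ler_peMr// mulr_ge0.
  lra.
(* The root [conj a] of [P] stays away from [a'], so the smallness of [x' P(a')] must come from
   [x' (a' - a)]. *)
have na' : sg <= cnorm (csub a' (cconj a)).
  apply: le_trans (ler_im_cnorm _) => /=; rewrite opprK.
  have := ler_im_cnorm (csub a a'); rewrite /= => h2.
  have := ler_normB (a'.2 + a.2) (a.2 - a'.2).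
  rewrite (_ : a'.2 + a.2 - (a.2 - a'.2) = 2 * a'.2); last by ring.
  rewrite normrM (@ger0_norm _ 2)//; lra.
have c1 : cnorm x' * cnorm (csub a a') <= 12 * h / sg ^+ 2.
  rewrite cnorm_subC.
  have : cnorm x' * cnorm (csub a' a) * sg <= 12 * h / sg.
    apply: le_trans nz; rewrite /z !cnormM mulrA ler_wpM2l//.
    by rewrite mulr_ge0// cnorm_ge0.
  by rewrite expr2 invfM mulrA -ler_pdivlMr.
split => //.
(* The same device for [d]: its real part and that of [a d] are small, hence so is its imaginary
   part. *)
pose d := csub x x'.
have ad : `|(cmul a d).1| <= 13 * h / sg ^+ 2.
  rewrite (_ : (cmul a d).1 = Y1 - (cmul (csub a a') x').1); last first.
    by rewrite /d /Y1 /cmul /csub /=; ring.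
  rewrite (le_trans (ler_normB _ _))//.
  have h1 : h <= h / sg ^+ 2 by rewrite ler_peMr// -exprVn exprn_ege1.
  have := ler_re_cnorm (cmul (csub a a') x'); rewrite cnormM; lra.
have d2 : `|d.2| <= 14 * h / sg ^+ 3.
  rewrite exprSr invfM mulrA ler_pdivlMr// mulrC.
  apply: (@le_trans _ _ (`|a.2| * `|d.2|)); first by rewrite ler_wpM2r.
  rewrite -normrM (_ : a.2 * d.2 = a.1 * d.1 - (cmul a d).1); last first.
    by rewrite /cmul /=; ring.
  have := ler_normB (a.1 * d.1) (cmul a d).1.
  have : `|a.1 * d.1| <= h by rewrite normrM -[leRHS]mul1r ler_pM.
  have h1 : h <= h / sg ^+ 2 by rewrite ler_peMr// -exprVn exprn_ege1.
  lra.
apply: le_trans (cnorm_le_sum _) _.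
have h1 : h <= h / sg ^+ 3 by rewrite ler_peMr// -exprVn exprn_ege1.
move: d2; rewrite /d /=; lra.
Qed.

Lemma cexp_inverse_lip (b l l' : cplx R) sg : 0 < sg ->
  cnorm b * cnorm (csub l l') <= 1 -> sg <= cnorm (cexp (cmul b l')) ->
  cnorm b * cnorm (csub l l') <=
  10 / sg * cnorm (csub (cexp (cmul b l)) (cexp (cmul b l'))).
Proof.
move=> sg0; rewrite -cnormM => /cexp_sub1_ge; set u := cmul b _ => h hs.
have -> : csub (cexp (cmul b l)) (cexp (cmul b l')) =
    cmul (cexp (cmul b l')) (csub (cexp u) (1, 0)).
  rewrite cmulBr -cexpD.
  have -> : cadd (cmul b l') u = cmul b l.
    by rewrite /cadd /u /cmul /csub /=; congr pair; ring.
  by rewrite (cmulC _ (1, 0)) cmul1.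
rewrite cnormM; apply: (le_trans h).
rewrite mulrA ler_wpM2r ?cnorm_ge0//.
by rewrite mulrAC ler_pdivlMr// ler_pM2l.
Qed.

(** Product rule. Varying [l] costs a factor [cnorm v], and [1 + cnorm v <= expR (cnorm v)] absorbs
    it; this is the origin of [m + 1] in the exponent. *)
Lemma cexp_mul_lip (x x' l l' v : cplx R) H m : 0 <= H -> 0 <= m ->
  cnorm l <= m -> cnorm l' <= m ->
  cnorm (csub x x') <= H -> cnorm x' * cnorm (csub l l') <= H ->
  cnorm (csub (cmul (cexp (cmul v l)) x) (cmul (cexp (cmul v l')) x')) <=
  3 * expR (cnorm v * (m + 1)) * H.
Proof.
move=> H0 m0 lm lm' hx hl.
have v0 := cnorm_ge0 v.
have vl : cnorm (cmul v l) <= cnorm v * m by rewrite cnormM ler_wpM2l.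
have vl' : cnorm (cmul v l') <= cnorm v * m by rewrite cnormM ler_wpM2l.
have -> : csub (cmul (cexp (cmul v l)) x) (cmul (cexp (cmul v l')) x') =
   cadd (cmul (cexp (cmul v l)) (csub x x'))
        (cmul (csub (cexp (cmul v l)) (cexp (cmul v l'))) x').
  by rewrite /csub /cadd /cmul /=; congr pair; ring.
rewrite (le_trans (cnormD _ _))// !cnormM.
have t1 : cnorm (cexp (cmul v l)) * cnorm (csub x x') <= expR (cnorm v * m) * H.
  by rewrite ler_pM ?cnorm_ge0// (le_trans (cnorm_cexp_le _))// ler_expR.
have t2 : cnorm (csub (cexp (cmul v l)) (cexp (cmul v l'))) * cnorm x' <=
    3 * expR (cnorm v * m) * (cnorm v * H).
  apply: (@le_trans _ _ (3 * expR (cnorm v * m) * (cnorm v * cnorm (csub l l')) * cnorm x')).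
    by rewrite ler_wpM2r ?cnorm_ge0// -cnormM cmulBr; exact: cexp_lip.
  rewrite -!mulrA ler_pM2l// ler_pM2l ?expR_gt0// ler_wpM2l//.
  by rewrite mulrC.
rewrite mulrDr mulr1 expRD; have := expR_ge1Dx (cnorm v).
have := expR_gt0 (cnorm v * m) => ep ev.
have : 3 * expR (cnorm v * m) * H * (1 + cnorm v) <=
    3 * expR (cnorm v * m) * H * expR (cnorm v).
  by rewrite ler_wpM2l// !mulr_ge0// ltW.
have : 0 <= expR (cnorm v * m) * H by rewrite mulr_ge0// ltW.
lra.
Qed.

(** Both numbers are near integers, and being within 1/8 of each other they are near the same one.
    No integer is named: the addition formula bounds [1 - cos (2 pi (y - y'))] by [4 c], and the
    angle is at most 1 because [pi < 4]. *)
Lemma one_sub_cos_close (y y' c h : R) : 0 <= h -> c <= h ^+ 2 / 2 -> c <= 1 ->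
  1 - cos (2 * pi * y) <= c -> 1 - cos (2 * pi * y') <= c ->
  8 * `|y - y'| <= 1 -> `|y - y'| <= h.
Proof.
move=> h0 ch c1 gy gy' yy'.
have p2 := pi_ge2 R; have p4 : pi < 4 :> R by have := @pihalf_lt2 R; lra.
set t := 2 * pi * y in gy; set t' := 2 * pi * y' in gy'.
have tt : t - t' = 2 * pi * (y - y') by rewrite /t /t'; ring.
have nt : `|t - t'| <= 1.
  rewrite tt !normrM (@ger0_norm _ 2)// (ger0_norm (pi_ge0 R)).
  have := normr_ge0 (y - y'); nra.
have := one_sub_cos_ge nt; rewrite cosB.
have := cos2Dsin2 t; have := cos2Dsin2 t'.
have := cos_le1 t; have := cos_le1 t'.
set C := cos t in gy *; set C' := cos t' in gy' *; set S := sin t; set S' := sin t'.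
move=> C1 C1' cs' cs low.
have ss : - (S * S') <= 2 * c.
  have := sqr_ge0 (S + S'); rewrite sqrrD.
  have : S ^+ 2 <= 2 * c by nra.
  have : S' ^+ 2 <= 2 * c by nra.
  lra.
have cc : 1 - C * C' <= 2 * c by nra.
have : (t - t') ^+ 2 / 8 <= 4 * c by lra.
rewrite tt !exprMn => h3.
have p24 : 4 <= pi ^+ 2 :> R by nra.
have : (y - y') ^+ 2 <= h ^+ 2.
  have := sqr_ge0 (y - y'); nra.
by rewrite -(real_normK (num_real (y - y'))) ler_pXn2r// nnegrE.
Qed.

End Rigidity.

Section ModularLabel.
Context {R : realType}.
Implicit Types (h y : R) (k : nat).

(* [floor (y / h)] modulo [k + 1]: finitely many labels, which still separate points
   already known to be within [k * h] of each other. *)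
Definition mod_label h k y : 'I_k.+1 := inord `|(Num.floor (y / h) %% k.+1%:Z)%Z|%N.

(** The two floors are congruent modulo [k + 1] and differ by less than [k + 1], so they are
    equal. *)
Lemma mod_label_eq h k y y' : 0 < h -> `|y - y'| <= k%:R * h ->
  mod_label h k y = mod_label h k y' -> `|y - y'| <= h.
Proof.
move=> h0 hk /(congr1 val); rewrite /= !inordK; last 2 first.
- by rewrite -ltz_nat gez0_abs ?modz_ge0// ltz_mod.
- by rewrite -ltz_nat gez0_abs ?modz_ge0// ltz_mod.
set f := Num.floor (y / h); set f' := Num.floor (y' / h) => e.
have {}e : (f %% k.+1%:Z)%Z = (f' %% k.+1%:Z)%Z.
  by rewrite -[LHS]gez0_abs ?modz_ge0// e gez0_abs// modz_ge0.
have d : (k.+1%:Z %| f - f')%Z by rewrite -eqz_mod_dvd; apply/eqP.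
have t1 := floor_itv (y / h); have t2 := floor_itv (y' / h).
rewrite -/f -/f' in t1 t2.
have hd : y / h - y' / h = (y - y') / h by ring.
have kd : `|y / h - y' / h| <= k%:R.
  by rewrite hd normrM normfV (gtr0_norm h0) ler_pdivrMr.
have ff : `|f%:~R - f'%:~R| < k.+1%:R :> R.
  move: kd t1 t2; rewrite -natr1 ler_norml ltr_norml !rmorphD /=.
  move=> /andP[? ?] /andP[? ?] /andP[? ?]; apply/andP; split; lra.
have {}ff : (`|f - f'| < k.+1)%N.
  by rewrite -ltz_nat abszE -(ltr_int R) intr_norm rmorphB.
have f0 : f - f' = 0.
  apply/eqP; move: d; rewrite dvdzE /= => d.
  case: (posnP `|f - f'|%N) => [/eqP|/dvdn_leq/(_ d)]; first by rewrite absz_eq0.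
  by rewrite leqNgt ff.
have {}f0 : f = f' by apply/eqP; rewrite -subr_eq0 f0.
have : `|(y - y') / h| <= 1.
  rewrite -hd; move: t1 t2; rewrite f0 !rmorphD /= ler_norml.
  move=> /andP[? ?] /andP[? ?]; apply/andP; split; lra.
by rewrite normrM normfV (gtr0_norm h0) ler_pdivrMr// mul1r.
Qed.

End ModularLabel.

Section Orbits.
Context {R : realType} {I : finType} (beta : I -> cplx R) (B : R).
Hypothesis beta_le : forall j, cnorm (beta j) <= B.
Implicit Types (om : nat -> I) (l w x v : cplx R).

Fixpoint log_sum om n : cplx R :=
  if n is n'.+1 then cadd (log_sum om n') (beta (om n')) else (0, 0).

(** The point [Lam_n w] of the overview, whose real part is the phase at time [n]. The parameter is
    the logarithm [l], so that linear parts multiply by adding exponents and no branch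
    intervenes. *)
Definition orbit_pt om l w n : cplx R := cmul (cexp (cmul (log_sum om n) l)) w.

Lemma orbit_ptS om l w n :
  orbit_pt om l w n.+1 = cmul (cexp (cmul (beta (om n)) l)) (orbit_pt om l w n).
Proof. by rewrite /orbit_pt /= cmulDl cexpD cmulA (cmulC (cexp (cmul (beta _) _))). Qed.

Lemma orbit_pt0 om l w : orbit_pt om l w 0 = w.
Proof.
by rewrite /orbit_pt /= (_ : cmul (0, 0) l = (0, 0)) ?cexp0 ?cmul1// /cmul /=;
  congr pair; ring.
Qed.

Lemma log_sum_eq om om' n : (forall j, (j < n)%N -> om j = om' j) ->
  log_sum om n = log_sum om' n.
Proof.
elim: n => //= n IH h; rewrite IH ?h// => j jn; apply: h.
exact: ltnW.
Qed.

Lemma orbit_pt_eq om om' l w n : (forall j, (j < n)%N -> om j = om' j) ->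
  orbit_pt om l w n = orbit_pt om' l w n.
Proof. by move=> /log_sum_eq h; rewrite /orbit_pt h. Qed.

Lemma log_sum_dist om n d :
  cnorm (csub (log_sum om (n + d)) (log_sum om n)) <= d%:R * B.
Proof.
elim: d => [|d IH]; first by rewrite addn0 /csub !subrr cnorm0 mul0r.
rewrite addnS -natr1 mulrDl mul1r.
apply: le_trans (lerD IH (beta_le (om (n + d)%N))).
apply: le_trans (cnormD _ _).
by rewrite /= /csub /cadd /=; rewrite le_eqVlt; apply/orP; left; apply/eqP;
  congr cnorm; congr pair; ring.
Qed.

Lemma orbit_pt_move om l w n n' : orbit_pt om l w n' =
  cmul (cexp (cmul (csub (log_sum om n') (log_sum om n)) l)) (orbit_pt om l w n).
Proof.
rewrite /orbit_pt cmulA -cexpD; congr (cmul (cexp _) _).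
by rewrite /cadd /cmul /csub /=; congr pair; ring.
Qed.

Lemma cnorm_orbit_pt_le om l w n kappa :
  (forall j, cnorm (cexp (cmul (beta j) l)) <= kappa) ->
  cnorm (orbit_pt om l w n) <= kappa ^+ n * cnorm w.
Proof.
move=> h; elim: n => [|n IH]; first by rewrite orbit_pt0 mul1r.
by rewrite orbit_ptS cnormM exprS -mulrA ler_pM ?cnorm_ge0.
Qed.

End Orbits.

Section Closeness.
Context {R : realType} {I : finType} (beta : I -> cplx R) (i : I) (m kappa sg B : R).
Hypotheses (m_ge0 : 0 <= m) (kappa_le1 : kappa <= 1) (sg_gt0 : 0 < sg)
  (sg_le1 : sg <= 1) (beta_le : forall j, cnorm (beta j) <= B)
  (beta_i : 0 < cnorm (beta i)).
Implicit Types (om : nat -> I) (l w x v : cplx R).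

(** Uniform version of the generic conditions: bounded logarithm, uniform contraction, and an [i]-th
    multiplier at distance at least [sg] from the real line. *)
Definition regular l : Prop :=
  [/\ cnorm l <= m, forall j, cnorm (cexp (cmul (beta j) l)) <= kappa
    & sg <= `|(cexp (cmul (beta i) l)).2|].

Definition cscale (j : nat) v : cplx R := (j%:R * v.1, j%:R * v.2).

(** The phase that would be seen [j] steps after [x] if all letters in between were [i]. It makes
    sense at every time; on an actual run of [i] it is a true phase of the orbit, see [obs_run]. *)
Definition obs l x (j : nat) : R := (cmul (cexp (cmul (cscale j (beta i)) l)) x).1.

Lemma obs0 l x : obs l x 0 = x.1.
Proof.
by rewrite /obs /cscale !mul0r (_ : cmul (0, 0) l = (0, 0)) ?cexp0 ?cmul1// /cmul /=;
  congr pair; ring.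
Qed.

Lemma obsS l x j : obs l x j.+1 = obs l (cmul (cexp (cmul (beta i) l)) x) j.
Proof.
rewrite /obs cmulA -cexpD; congr (cmul (cexp _) x).1.
by rewrite /cscale /cmul /cadd /= -natr1; congr pair; ring.
Qed.

Lemma obs_cexp l x v j : obs l (cmul (cexp (cmul v l)) x) j =
  (cmul (cexp (cmul (cadd (cscale j (beta i)) v) l)) x).1.
Proof. by rewrite /obs cmulA -cexpD -cmulDl. Qed.

Lemma obs_run om l w n j : (forall d, (d < j)%N -> om (n + d)%N = i) ->
  obs l (orbit_pt beta om l w n) j = (orbit_pt beta om l w (n + j)).1.
Proof.
elim: j n => [|j IH] n h; first by rewrite obs0 addn0.
rewrite obsS -{1}(h 0%N)// addn0 -orbit_ptS IH ?addSnnS// => d dj.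
by rewrite addSnnS h.
Qed.

Lemma cnorm_cscale j v : cnorm (cscale j v) = j%:R * cnorm v.
Proof.
rewrite (_ : cscale j v = cmul (j%:R, 0) v); last first.
  by rewrite /cscale /cmul /=; congr pair; ring.
by rewrite cnormM /cnorm /= expr0n addr0 sqrtr_sqr ger0_norm.
Qed.

Definition close h l x l' x' : Prop :=
  forall j, (j < 4)%N -> `|obs l x j - obs l' x' j| <= h.

(** The two smallness conditions behind rigidity: the first places [beta i * (l - l')] where exp has
    its local inverse bound, the second puts the two multipliers within [sg] of each other. *)
Definition nearby l l' : Prop :=
  cnorm (beta i) * cnorm (csub l l') <= 1 /\
  3 * expR (cnorm (beta i) * m) * (cnorm (beta i) * cnorm (csub l l')) <= sg.

(** The 15 comes from the bound on [x - x']; the 120 is 10 from [cexp_inverse_lip] times 12 from the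
    bound on the difference of the multipliers. *)
Definition rigidity_const : R := (15 + 120 / cnorm (beta i)) / sg ^+ 3.

Lemma rigidity_const_gt0 : 0 < rigidity_const.
Proof. by rewrite divr_gt0 ?exprn_gt0// addr_gt0// divr_gt0. Qed.

Lemma close_rigid h l x l' x' : 0 <= h -> regular l -> regular l' -> nearby l l' ->
  close h l x l' x' ->
  cnorm (csub x x') <= rigidity_const * h /\
  cnorm x' * cnorm (csub l l') <= rigidity_const * h.
Proof.
move=> h0 [lm lk ls] [lm' lk' ls'] [n1 n2] cl.
set b := beta i in lk lk' ls ls' n1 n2 *.
have ab : cnorm (csub (cexp (cmul b l)) (cexp (cmul b l'))) <= sg.
  apply: le_trans n2; rewrite -[cnorm b * cnorm (csub l l')]cnormM cmulBr.
  by apply: cexp_lip; rewrite cnormM ler_wpM2l ?cnorm_ge0.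
have [] := @four_values_rigid _ x x' (cexp (cmul b l)) (cexp (cmul b l')) sg h => //.
- exact: le_trans (lk _) kappa_le1.
- exact: le_trans (lk' _) kappa_le1.
- by have := cl 0%N isT; rewrite !obs0.
- by have := cl 1%N isT; rewrite !obsS !obs0.
- by have := cl 2 isT; rewrite !obsS !obs0.
- by have := cl 3 isT; rewrite !obsS !obs0.
move=> r1 r2; have sg3 : 0 < sg ^+ 3 by rewrite exprn_gt0.
have q0 : 0 <= 120 / cnorm b by rewrite divr_ge0// cnorm_ge0.
split.
  apply: le_trans r2 _; rewrite /rigidity_const [leRHS]mulrAC ler_pM2r ?invr_gt0//.
  by rewrite ler_wpM2r// lerDl.
have := cexp_inverse_lip sg_gt0 n1 (le_trans ls' (ler_im_cnorm _)).
move=> /(ler_wpM2l (cnorm_ge0 x')).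
rewrite [in X in X -> _](mulrCA (cnorm x')) [in X in X -> _](mulrCA (cnorm x')) => r3.
have {}r3 := le_trans r3 (ler_wpM2l (divr_ge0 (ler0n _ 10) (ltW sg_gt0)) r1).
rewrite -(ler_pM2l beta_i); apply: le_trans r3 _.
rewrite /rigidity_const -/b.
have -> : 10 / sg * (12 * h / sg ^+ 2) = 120 * h / sg ^+ 3.
  by field; rewrite gt_eqF.
have -> : cnorm b * ((15 + 120 / cnorm b) / sg ^+ 3 * h) =
   (15 * cnorm b + 120) * h / sg ^+ 3 by field; rewrite !gt_eqF.
by rewrite ler_pM2r ?invr_gt0// ler_wpM2r// lerDr mulr_ge0// cnorm_ge0.
Qed.

(* Closeness at one time gives closeness at any other time of the orbit, which is
   obtained by multiplication by [cexp (v * l)]; the loss depends only on [|v|]. *)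
Lemma close_transfer h l x l' x' v V : 0 <= h -> regular l -> regular l' ->
  nearby l l' -> cnorm v + 3 * cnorm (beta i) <= V -> close h l x l' x' ->
  close (3 * expR (V * (m + 1)) * (rigidity_const * h))
    l (cmul (cexp (cmul v l)) x) l' (cmul (cexp (cmul v l')) x').
Proof.
move=> h0 rl rl' nl hV cl j j4.
have [c1 c2] := close_rigid h0 rl rl' nl cl.
have [lm _ _] := rl; have [lm' _ _] := rl'.
have H0 : 0 <= rigidity_const * h by rewrite mulr_ge0// ltW// rigidity_const_gt0.
rewrite !obs_cexp; set v' := cadd _ v.
have := cexp_mul_lip v' H0 m_ge0 lm lm' c1 c2.
move=> hh; apply: (le_trans (ler_re_cnorm (csub _ _))); apply: (le_trans hh).
rewrite ler_wpM2r// ler_pM2l// ler_expR ler_wpM2r ?addr_ge0//.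
apply: le_trans hV; rewrite (le_trans (cnormD _ _))// addrC lerD2l cnorm_cscale.
by rewrite ler_wpM2r ?cnorm_ge0// ler_nat -ltnS.
Qed.

End Closeness.

(** * Coding of orbits *)

Section Labels.
Context {R : realType} {I : finType} (beta : I -> cplx R) (i : I) (m kappa sg B : R).
Hypotheses (m_ge0 : 0 <= m) (kappa_le1 : kappa <= 1) (kappa_gt0 : 0 < kappa)
  (sg_gt0 : 0 < sg) (sg_le1 : sg <= 1) (beta_le : forall j, cnorm (beta j) <= B)
  (beta_i : 0 < cnorm (beta i)).
(** [L] is the block length and [k] bounds the loss of precision over one block. Orbits are followed
    at precision [h], sharpened to [h'] when the phases of a run pass the near-integer test of
    threshold [c]. [eta] is the initial precision on [l], [E] bounds the last orbit point, and [k0]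
    makes the initial labels unambiguous. *)
Context (L k k0 D : nat) (h h' c eta E : R).
Hypotheses
  (k_big : 3 * expR ((L%:R + 3) * B * (m + 1)) * rigidity_const beta i sg <= k%:R)
  (h_gt0 : 0 < h) (h_small : 8 * (k%:R * h) <= 1)
  (h'_ge0 : 0 <= h') (h'_small : k%:R * h' <= h) (c_small : c <= h' ^+ 2 / 2) (c_le1 : c <= 1)
  (eta_gt0 : 0 < eta) (eta_small1 : cnorm (beta i) * (2 * eta) <= 1)
  (eta_small2 : 3 * expR (cnorm (beta i) * m) * (cnorm (beta i) * (2 * eta)) <= sg)
  (k0_big1 : 2 * m <= k0%:R * eta) (k0_big2 : 2 * E <= k0%:R * h).
Implicit Types (om : nat -> I) (l w x v : cplx R).

Local Notation orb := (orbit_pt beta).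
Local Notation regular := (regular beta i m kappa sg).
Local Notation close := (close beta i).
Local Notation Ca := (rigidity_const beta i sg).

Lemma close_orbit om g l w l' w' n n' : 0 <= g -> regular l -> regular l' ->
  nearby beta i m sg l l' -> (n' <= n <= n' + L)%N ->
  close g l (orb om l w n) l' (orb om l' w' n) ->
  close (k%:R * g) l (orb om l w n') l' (orb om l' w' n').
Proof.
move=> g0 rl rl' nl /andP[nn' nL] cl.
rewrite (orbit_pt_move _ om l w n) (orbit_pt_move _ om l' w' n).
(* At most [L] letters separate the two times; the 3 accounts for the further steps hidden in
   [obs]. *)
have hV : cnorm (csub (log_sum beta om n') (log_sum beta om n)) + 3 * cnorm (beta i) <=
    (L%:R + 3) * B.
  rewrite [leRHS]mulrDl lerD// ?ler_wpM2l// cnorm_subC -{1}(subnKC nn').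
  apply: (le_trans (log_sum_dist beta_le _ _ _)).
  by rewrite ler_wpM2r ?(le_trans (ltW beta_i))// ler_nat leq_subLR.
move=> j j4; apply: le_trans
  (close_transfer m_ge0 kappa_le1 sg_gt0 sg_le1 beta_i g0 rl rl' nl hV cl j4) _.
by rewrite mulrA ler_wpM2r.
Qed.

Definition run om n := all (fun j => om (n + j)%N == i) (iota 0 4).
(** The offsets stop at [L - 4], so that the four letters of the run lie inside the block. *)
Definition nice om b := has (fun d => run om (b * L + d)) (iota 0 (L - 3)).
Definition run_pos om b := (b * L + find (fun d => run om (b * L + d)) (iota 0 (L - 3)))%N.
(** Proximity to the integers, in the form in which it enters the Fourier product. *)
Definition near_int (y : R) := 1 - cos (2 * pi * y) <= c.
Definition all_near om l w b :=
  all (fun j => near_int (orb om l w (run_pos om b + j)).1) (iota 0 4).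
Definition block_ok om l w b := nice om b && all_near om l w b.

Lemma nice_run om b : nice om b ->
  [/\ (b * L <= run_pos om b)%N, (run_pos om b + 3 < b.+1 * L)%N &
      forall d, (d < 4)%N -> om (run_pos om b + d)%N = i].
Proof.
move=> ni; have := ni; rewrite /nice has_find size_iota => fl.
split; first exact: leq_addr.
  by move: fl; rewrite /run_pos mulSn; move: (find _ _) => f; clear; lia.
move=> d d4; have /allP := nth_find 0%N ni; rewrite nth_iota// add0n.
by move=> /(_ d); rewrite mem_iota => /(_ d4)/eqP.
Qed.

(* A nice block whose run of four phases is near the integers needs no label: the
   integers, hence the orbit up to [h], are determined by the following block. *)
Definition block_label om l w b : option {ffun 'I_4 -> 'I_k.+1} :=
  if block_ok om l w b then None
  else Some [ffun j : 'I_4 => mod_label h k (obs beta i l (orb om l w (b * L)) j)].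

Definition label_type M :=
  (({ffun 'I_4 -> 'I_k0.+1} * ('I_k0.+1 * 'I_k0.+1)) *
   {ffun 'I_M -> option {ffun 'I_4 -> 'I_k.+1}})%type.

(** Decoding runs backwards in time: the initial data describe [l] and the point at time [L * M],
    where the orbit has bounded size, and the block labels lead back to time 0. *)
Definition orbit_label om M (p : cplx R * cplx R) : label_type M :=
  (([ffun j : 'I_4 => mod_label h k0 (obs beta i p.1 (orb om p.1 p.2 (L * M)) j)],
    (mod_label eta k0 p.1.1, mod_label eta k0 p.1.2)),
   [ffun b : 'I_M => block_label om p.1 p.2 b]).

Definition admissible om M (p : cplx R * cplx R) : Prop :=
  [/\ regular p.1, 1 <= cnorm (orb om p.1 p.2 (L * M)) &
      cnorm (orb om p.1 p.2 (L * M)) <= E].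

Lemma obs_le l x j : regular l -> `|obs beta i l x j| <= cnorm x.
Proof.
move=> [_ lk _]; elim: j x => [|j IH] x; first by rewrite obs0 ler_re_cnorm.
rewrite obsS (le_trans (IH _))// cnormM -[leRHS]mul1r ler_wpM2r ?cnorm_ge0//.
exact: le_trans (lk _) kappa_le1.
Qed.

Lemma label_nearby om M p p' : admissible om M p -> admissible om M p' ->
  orbit_label om M p = orbit_label om M p' -> nearby beta i m sg p.1 p'.1.
Proof.
move=> [[lm _ _] _ _] [[lm' _ _] _ _] [_ e1 e2 _].
suff lle : cnorm (csub p.1 p'.1) <= 2 * eta.
  split; first by rewrite (le_trans _ eta_small1)// ler_pM2l.
  by rewrite (le_trans _ eta_small2)// ler_wpM2l ?mulr_ge0 ?expR_ge0// ler_pM2l.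
have d1 : `|p.1.1 - p'.1.1| <= eta.
  apply: mod_label_eq e1 => //; apply: le_trans k0_big1.
  have := ler_normB p.1.1 p'.1.1.
  have := ler_re_cnorm p.1; have := ler_re_cnorm p'.1; lra.
have d2 : `|p.1.2 - p'.1.2| <= eta.
  apply: mod_label_eq e2 => //; apply: le_trans k0_big1.
  have := ler_normB p.1.2 p'.1.2.
  have := ler_im_cnorm p.1; have := ler_im_cnorm p'.1; lra.
by rewrite (le_trans (cnorm_le_sum _))//=; lra.
Qed.

(** Backward induction on blocks. Precision [h] at the end of a block gives [k * h] inside it. If
    the block carries a label, [mod_label] restores [h]. Otherwise the phases of its run are near
    integers and within 1/8 of each other, hence within [h'], and moving to the start of the block
    costs [k * h' <= h]. *)
Lemma label_close om M p p' : admissible om M p -> admissible om M p' ->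
  orbit_label om M p = orbit_label om M p' ->
  forall d, (d <= M)%N ->
  close h p.1 (orb om p.1 p.2 ((M - d) * L)) p'.1 (orb om p'.1 p'.2 ((M - d) * L)).
Proof.
move=> ap ap' e; have nl := label_nearby ap ap' e.
have [rl _ xE] := ap; have [rl' _ xE'] := ap'.
elim=> [_|d IH dM].
  rewrite subn0 mulnC => j j4.
  have [/ffunP/(_ (Ordinal j4))] := e; rewrite !ffunE /= => ej _ _ _.
  apply: mod_label_eq ej => //; apply: le_trans k0_big2.
  have := obs_le (orb om p.1 p.2 (L * M)) j rl.
  have := obs_le (orb om p'.1 p'.2 (L * M)) j rl'.
  have := ler_normB (obs beta i p.1 (orb om p.1 p.2 (L * M)) j)
    (obs beta i p'.1 (orb om p'.1 p'.2 (L * M)) j).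
  lra.
have {IH} := IH (ltnW dM).
have -> : (M - d)%N = (M - d.+1).+1 by move: dM; clear; lia.
set b := (M - d.+1)%N => cl.
have bM : (b < M)%N by rewrite /b; move: dM; clear; lia.
have [_ _ _ /ffunP/(_ (Ordinal bM))] := e; rewrite !ffunE /= /block_label.
case: ifP => [/andP[ni okp]|_]; case: ifP => //.
  move=> /andP[_ okp'] _; have [p1 p2 p3] := nice_run ni; set n := run_pos om b in p1 p2 p3 okp okp'.
  have cn : close h' p.1 (orb om p.1 p.2 n) p'.1 (orb om p'.1 p'.2 n).
    have n1 : (n <= b.+1 * L <= n + L)%N.
      by apply/andP; split; move: p1 p2; rewrite mulSn; clear; lia.
    have {cl} := close_orbit (ltW h_gt0) rl rl' nl n1 cl.
    move=> cl j j4; have := cl j j4.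
    have rn d' : (d' < j)%N -> om (n + d')%N = i by move=> dj; apply: p3; move: dj j4; clear; lia.
    rewrite !obs_run// => cj.
    have jin : j \in iota 0 4 by rewrite mem_iota.
    apply: (one_sub_cos_close h'_ge0 c_small c_le1).
    + by have /allP/(_ j jin) := okp.
    + by have /allP/(_ j jin) := okp'.
    + by apply: le_trans h_small; rewrite ler_pM2l.
  have n2 : (b * L <= n <= b * L + L)%N.
    by apply/andP; split=> //; move: p2; rewrite mulSn; clear; lia.
  move=> j j4; apply: le_trans h'_small.
  exact: (close_orbit h'_ge0 rl rl' nl n2 cn).
move=> _ eb; have n2 : (b * L <= b.+1 * L <= b * L + L)%N by rewrite mulSn addnC leq_addr leqnn.
have {}cl := close_orbit (ltW h_gt0) rl rl' nl n2 cl.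
move=> j j4; case: eb => /ffunP/(_ (Ordinal j4)); rewrite !ffunE /=.
by apply: mod_label_eq => //; exact: cl.
Qed.

Definition label_some M (t : label_type M) : nat := (\sum_(b < M) isSome (t.2 b))%N.
Definition not_nice om M : nat := (\sum_(b < M) ~~ nice om b)%N.
Definition bad_blocks om l w M : nat := (\sum_(b < M) (nice om b && ~~ all_near om l w b))%N.

Lemma label_some_orbit om M p :
  label_some (orbit_label om M p) = (not_nice om M + bad_blocks om p.1 p.2 M)%N.
Proof.
rewrite /label_some /not_nice /bad_blocks -big_split /=; apply: eq_bigr => b _.
by rewrite ffunE /block_label /block_ok; case: nice; case: all_near.
Qed.

(** One representative per label; a label that nobody realises yields the default pair, a harmless
    extra centre. Blocks that are not nice always carry a label, so the threshold allows for them
    besides about [M / D] bad ones. *)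
Definition centers om M : seq (cplx R) :=
  [seq cexp (xget ((0, 0), (0, 0)) [set p | admissible om M p /\ orbit_label om M p = t]).1
     | t <- enum {: label_type M} & (D * label_some t <= M + D * not_nice om M)%N].

(** Rigidity at time 0 bounds [cnorm w * cnorm (l - l')] by [Ca * h], while contraction forces
    [cnorm w] to be at least [kappa ^ - (L * M)]. The factor [3 * expR m] passes from [l] to
    [lam]. *)
Definition radius M : R := 3 * expR m * (Ca * h) * kappa ^+ (L * M).

Lemma radius_ge0 M : 0 <= radius M.
Proof.
rewrite /radius; have := ltW (rigidity_const_gt0 sg_gt0 beta_i); move: Ca => C C0.
by rewrite !mulr_ge0 ?expR_ge0 ?exprn_ge0 ?(ltW kappa_gt0) ?(ltW h_gt0).
Qed.

Lemma centers_cover om M (lam w : cplx R) : lam != (0, 0) ->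
  admissible om M (clog lam, w) -> (D * bad_blocks om (clog lam) w M < M)%N ->
  boxes (centers om M) (radius M) lam.
Proof.
move=> lam0 ap few; set p := (clog lam, w) in ap.
pose S := [set p' | admissible om M p' /\ orbit_label om M p' = orbit_label om M p].
have Sp : S p by [].
have [] := xgetPex ((0, 0), (0, 0)) (ex_intro _ p Sp : exists p, S p).
set p' := xget _ S => ap' e.
exists (cexp p'.1).
  apply/mapP; exists (orbit_label om M p) => //.
  by rewrite mem_filter mem_enum andbT label_some_orbit mulnDr addnC leq_add2r ltnW.
have nl := label_nearby ap' ap e.
have := label_close ap' ap e (leqnn M); rewrite subnn mul0n !orbit_pt0 => cl.
have [rl x1 _] := ap; have [rl' _ _] := ap'.
have [_] := close_rigid kappa_le1 sg_gt0 sg_le1 beta_i (ltW h_gt0) rl' rl nl cl.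
rewrite /p /= => c2.
have [lm lk _] := rl; have [lm' _ _] := rl'.
have wk : 1 <= kappa ^+ (L * M) * cnorm w.
  exact: le_trans x1 (cnorm_orbit_pt_le om w (L * M) lk).
have kM0 : 0 < kappa ^+ (L * M) by rewrite exprn_gt0.
have dl : cnorm (csub (clog lam) p'.1) <= Ca * h * kappa ^+ (L * M).
  rewrite cnorm_subC.
  rewrite -[leLHS]mul1r; apply: (le_trans (ler_wpM2r (cnorm_ge0 _) wk)).
  by rewrite -[leLHS]mulrA [leRHS]mulrC ler_wpM2l// ltW.
have : cnorm (csub lam (cexp p'.1)) <= radius M.
  rewrite -{1}(clogK lam0) (le_trans (cexp_lip lm lm'))// /radius -[leRHS]mulrA.
  by rewrite ler_wpM2l// mulr_ge0// expR_ge0.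
by move=> dr; split; [have := ler_re_cnorm (csub lam (cexp p'.1))|
  have := ler_im_cnorm (csub lam (cexp p'.1))]; rewrite /= => /le_trans; apply.
Qed.

(** Weighted counting. In each block [None] weighs 1 and the [K = (k + 1)^4] labels weigh [1 / K]
    each, in total 2. A retained code has at most [2 M / D] labelled blocks, so its weight is at
    least [Q ^ - (2 M)]. The exponent 6 counts four phases and two coordinates of [l]. *)
Lemma size_centers om M (Q : nat) : (0 < Q)%N -> (k.+1 ^ 4 <= Q ^ D)%N ->
  (D * not_nice om M <= M)%N ->
  (size (centers om M))%:R <= k0.+1%:R ^+ 6 * (2 * Q%:R ^+ 2) ^+ M :> R.
Proof.
move=> Q0 kQ few.
pose K : R := (k.+1 ^ 4)%:R; have K0 : 0 < K by rewrite ltr0n expn_gt0.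
pose wt (o : option {ffun 'I_4 -> 'I_k.+1}) : R := if o is Some _ then K^-1 else 1.
have wt0 o : 0 <= wt o by case: o => //= _; rewrite invr_ge0 ltW.
have wtsum : \sum_o wt o = 2.
  rewrite (bigD1 None)//= (eq_bigr (fun=> K^-1)); last by case.
  rewrite sumr_const cardC1 card_option /= card_ffun !card_ord -[_ *+ _]mulr_natr.
  by rewrite mulVf ?gt_eqF.
have wtprod (f : {ffun 'I_M -> option {ffun 'I_4 -> 'I_k.+1}}) :
    \prod_b wt (f b) = K^-1 ^+ (\sum_(b < M) isSome (f b))%N.
  elim/big_ind2: _ => [|x n y n' -> ->|b _]; rewrite ?expr0 ?exprD//.
  by case: (f b) => //=; rewrite ?expr1.
pose G (t : label_type M) := Q%:R ^+ (2 * M) * \prod_b wt (t.2 b).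
have G0 t : 0 <= G t by rewrite mulr_ge0 ?exprn_ge0// prodr_ge0.
apply: (@le_trans _ _ (\sum_t G t)).
  rewrite size_map size_filter -sum1_count natr_sum big_enum_cond /=.
  rewrite [leRHS](bigID (fun t => D * label_some t <= M + D * not_nice om M)%N) /=.
  rewrite -[leLHS]addr0 lerD ?sumr_ge0//; apply: ler_sum => t ht.
  rewrite /G wtprod exprVn ler_pdivlMr ?exprn_gt0// mul1r.
  apply: (@le_trans _ _ ((Q ^ D)%:R ^+ label_some t)).
    by rewrite lerXn2r ?nnegrE ?ler0n// ler_nat.
  rewrite natrX -exprM ler_weXn2l ?ler1n//; move: ht few; clear; lia.
rewrite /G -mulr_sumr.
have -> : \sum_(t : label_type M) \prod_b wt (t.2 b) = k0.+1%:R ^+ 6 * 2 ^+ M.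
  rewrite -(pair_bigA _ (fun (_ : {ffun 'I_4 -> 'I_k0.+1} * ('I_k0.+1 * 'I_k0.+1))
    (f : {ffun 'I_M -> option {ffun 'I_4 -> 'I_k.+1}}) => \prod_b wt (f b))) /= sumr_const.
  rewrite -(bigA_distr_bigA (fun=> wt)) /= (eq_bigr (fun=> 2)) ?prodr_const; last first.
    by move=> b _; exact: wtsum.
  rewrite !card_prod card_ffun !card_ord -[LHS]mulr_natl.
  rewrite (_ : (_ * _)%N = (k0.+1 ^ 6)%N) ?natrX//.
  by rewrite -[6%N]/(4 + 2)%N expnD.
by rewrite [in leRHS]exprMn -exprM mulrCA (mulrC (_ ^+ (2 * M))).
Qed.

End Labels.

(** * The Erdős-Kahane cover *)

Lemma exprn_small {R : realType} (x e : R) : 0 <= x -> x < 1 -> 0 < e ->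
  exists n, x ^+ n <= e.
Proof.
move=> x0 x1 e0.
have : (fun n => 1 * x ^+ n) @ \oo --> (0 : R).
  by apply: cvg_geometric; rewrite ger0_norm.
move=> /cvgrPdist_le /(_ e e0) [n _ hn]; exists n; have := hn n (leqnn n).
by rewrite /= sub0r normrN mul1r => /(le_trans (ler_norm _)).
Qed.

Section NiceBlocks.
Context {I : finType} (i : I).
Implicit Types om : nat -> I.

Lemma no_run4_run om n s : ~~ no_run4 i n [seq om j | j <- iota s (4 * n)] ->
  exists2 d, (d < 4 * n - 3)%N & run i om (s + d).
Proof.
elim: n s => // n IH s; rewrite mulnS iotaD map_cat /=.
rewrite negb_and negbK drop0 take0 => /orP[/eqP e|].
  by exists 0%N; [lia|rewrite /run /= !addn0 addn1 addn2 addn3; case: e => -> -> -> ->; rewrite !eqxx].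
move=> /IH[d hd hr]; exists (4 + d)%N; [lia|by rewrite addnA].
Qed.

Lemma count_blocks_sum om bad L M s :
  count_blocks bad L M [seq om j | j <- iota s (L * M)] =
  (\sum_(b < M) bad [seq om j | j <- iota (s + b * L) L])%N.
Proof.
elim: M s => [|M IH] s; first by rewrite big_ord0.
rewrite mulnS iotaD map_cat /= take_size_cat ?size_map ?size_iota//.
rewrite drop_size_cat ?size_map ?size_iota// IH big_ord_recl /= mul0n addn0.
by congr addn; apply: eq_bigr => b _; rewrite mulSn addnA.
Qed.

(** An inequality, because [nice] also accepts runs that are not aligned. *)
Lemma not_nice_le om n M :
  (not_nice i (4 * n) om M <=
   count_blocks (no_run4 i n) (4 * n) M (prefix_word om (4 * n * M)))%N.
Proof.
rewrite count_blocks_sum; apply: leq_sum => b _; rewrite add0n.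
case: (boolP (no_run4 _ _ _)) => [_|/no_run4_run[d dn hr]]; first exact: leq_b1.
suff -> : nice i (4 * n) om b by [].
by apply/hasP; exists d => //; rewrite mem_iota.
Qed.

Lemma nth_prefix_word om n j : (j < n)%N -> nth i (prefix_word om n) j = om j.
Proof. by move=> jn; rewrite (nth_map 0%N) ?size_iota// nth_iota. Qed.

Lemma prefix_word_nth om n : prefix_word (nth i (prefix_word om n)) n = prefix_word om n.
Proof.
apply/eq_in_map => j; rewrite mem_iota add0n => /andP[_ jn].
exact: nth_prefix_word.
Qed.

End NiceBlocks.

(** Niceness is dropped here: what matters for decay is a time in the block with letter [i] and
    phase away from the integers. Each block counts at most once. *)
Definition bad_count {R : realType} {I : finType} (beta : I -> cplx R) (i : I) (L : nat)
    (c : R) (om : nat -> I) (l w : cplx R) (M : nat) : nat :=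
  (\sum_(b < M) has (fun d => (om (b * L + d)%N == i) &&
     (c < 1 - cos (2 * pi * (orbit_pt beta om l w (b * L + d)).1)))%R (iota 0 L))%N.

Lemma bad_blocks_le {R : realType} {I : finType} (beta : I -> cplx R) (i : I) (L : nat)
    (c : R) (om om' : nat -> I) (l w : cplx R) (M : nat) :
  (forall j, (j < L * M)%N -> om j = om' j) ->
  (bad_blocks beta i L c om l w M <= bad_count beta i L c om' l w M)%N.
Proof.
move=> ee; apply: leq_sum => b _.
case: (boolP (nice i L om b)) => //= ni; case: (boolP (all_near _ _ _ _ _ _ _ _)) => //= nn.
have [p1 p2 p3] := nice_run ni.
have bL : (b.+1 * L <= L * M)%N by rewrite (mulnC L) leq_mul2r ltn_ord orbT.
suff -> : has (fun d => (om' (b * L + d)%N == i) &&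
     (c < 1 - cos (2 * pi * (orbit_pt beta om' l w (b * L + d)).1)))%R (iota 0 L) by [].
have [j] := allPn nn; rewrite mem_iota add0n => /andP[_ j4]; rewrite /near_int -ltNge => hj.
apply/hasP; exists (run_pos i L om b - b * L + j)%N.
  by rewrite mem_iota; move: p1 p2 j4; rewrite mulSn; clear; lia.
rewrite addnA subnKC// -ee; last by move: p2 bL j4; clear; lia.
rewrite p3// eqxx andTb (_ : orbit_pt beta om' l w _ = orbit_pt beta om l w (run_pos i L om b + j))//.
apply: orbit_pt_eq => t tn; rewrite ee//; move: tn p2 bL j4; clear; lia.
Qed.

Section ErdosKahane.
Context {R : realType} {I : finType} {i0 : I} (beta : I -> cplx R) (i : I).
Context (q : I -> R) (P : probability (Omega i0) R) (m kappa sg B : R).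
Hypotheses (hP : bernoulli_measure q P) (qi : 0 < q i) (bi : beta i != (0, 0))
  (m_ge0 : 0 <= m) (kappa_gt0 : 0 < kappa) (kappa_lt1 : kappa < 1)
  (sg_gt0 : 0 < sg) (sg_le1 : sg <= 1) (beta_le : forall j, cnorm (beta j) <= B).

(** The order of the constants avoids a circle. [C1] bounds the loss per letter and
    [Q = C1 ^ (16 e)] is fixed before [D]. Then [D] is taken so large that [kappa ^ L], with
    [L = 4 e D], is at most [1 / (2 Q^2)]. As [k + 1 = C1 ^ L], one has [(k + 1)^4 = Q ^ D], and the
    growth [(2 Q^2) ^ M] of the number of boxes is compensated by the radius. *)
Lemma erdos_kahane :
  exists (cs : nat -> seq I -> seq (cplx R)) (r : nat -> R) (C c : R) (L D : nat),
  [/\ [/\ 0 < C, 0 < c, (0 < L)%N & (0 < D)%N],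
    {ae P, forall om : Omega i0, exists N, forall M, (N <= M)%N ->
      [/\ 0 <= r M, r M <= C * 2^-1 ^+ M &
          (size (cs M (prefix_word om (L * M))))%:R * r M <= C]} &
    forall (om : nat -> I) (lam w : cplx R) (M : nat), lam != (0, 0) ->
      regular beta i m kappa sg (clog lam) ->
      1 <= cnorm (orbit_pt beta om (clog lam) w (L * M)) ->
      cnorm (orbit_pt beta om (clog lam) w (L * M)) <= expR (L%:R * B * m) ->
      ~ boxes (cs M (prefix_word om (L * M))) (r M) lam ->
      (M <= D * bad_count beta i L c om (clog lam) w M)%N].
Proof.
have [q0 q1 hq] := hP.
have qi1 : q i <= 1 by rewrite -q1 (bigD1 i)//= lerDl sumr_ge0.
have beta_i : 0 < cnorm (beta i) by rewrite cnorm_gt0.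
have B0 : 0 <= B := le_trans (ltW beta_i) (beta_le i).
have [e he] : exists e, (1 - q i ^+ 4) ^+ e <= 4^-1.
  by apply: exprn_small => //; rewrite ?subr_ge0 ?exprn_ile1 ?(ltW qi)// ltrBlDr ltrDl exprn_gt0.
have e0 : (0 < e)%N by case: e he => //; rewrite expr0; lra.
pose Ca := rigidity_const beta i sg.
have Ca0 : 0 < Ca := rigidity_const_gt0 sg_gt0 beta_i.
(* Since [L + 3 <= 4 L], the exponential in [k_big] is at most [X ^ L]; likewise [3 Ca + 1] is at
   most its own [L]-th power. *)
pose X := expR (4 * B * (m + 1)).
have X1 : 1 <= X by rewrite -expR0 ler_expR !mulr_ge0// addr_ge0.
pose C1 := Num.Def.archi_bound ((3 * Ca + 1) * X).
have C1X : (3 * Ca + 1) * X < C1%:R by apply: archi_boundP; rewrite mulr_ge0 ?expR_ge0//; lra.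
have C11 : (1 < C1)%N.
  by rewrite -(ltr_nat R); apply: le_lt_trans C1X; nra.
have C10 : (0 < C1)%N := ltnW C11.
pose Q := (C1 ^ (16 * e))%N.
have Q0 : (0 < Q)%N by rewrite expn_gt0 C10.
have Q1 : 1 <= Q%:R :> R by rewrite ler1n.
have QQ : 1 <= Q%:R ^+ 2 :> R by rewrite exprn_ege1.
have [D hD] : exists D, (kappa ^+ (4 * e)) ^+ D <= (2 * Q%:R ^+ 2)^-1.
  apply: exprn_small; rewrite ?exprn_ge0 ?(ltW kappa_gt0)//.
    by rewrite exprn_ilt1 ?(ltW kappa_gt0)// muln_eq0 -lt0n.
  by rewrite invr_gt0 mulr_gt0// exprn_gt0// ltr0n.
have D0 : (0 < D)%N.
  rewrite lt0n; apply/negP => /eqP D0; move: hD; rewrite D0 expr0.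
  have : (2 * Q%:R ^+ 2)^-1 < 1 :> R by rewrite invf_lt1; lra.
  lra.
pose L := (4 * (e * D))%N.
have L0 : (0 < L)%N by rewrite !muln_gt0 e0 D0.
pose k := (C1 ^ L).-1.
have k1 : k.+1 = (C1 ^ L)%N by rewrite prednK// expn_gt0 C10.
have k_big : 3 * expR ((L%:R + 3) * B * (m + 1)) * Ca <= k%:R.
  have : (3 * Ca + 1) * X ^+ L <= k.+1%:R.
    rewrite k1 natrX.
    apply: (@le_trans _ _ (((3 * Ca + 1) * X) ^+ L)).
      rewrite exprMn ler_wpM2r ?exprn_ge0 ?expR_ge0//.
      by rewrite -[leLHS]expr1 ler_weXn2l//; lra.
    rewrite lerXn2r ?nnegrE ?ler0n ?(ltW C1X)//.
    by apply: mulr_ge0; [lra|exact: expR_ge0].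
  have XL : 1 <= X ^+ L by rewrite exprn_ege1.
  have : expR ((L%:R + 3) * B * (m + 1)) <= X ^+ L.
    rewrite -expRM_natl ler_expR !mulrA ler_wpM2r ?addr_ge0// ler_wpM2r//.
    have : 1 <= L%:R :> R by rewrite ler1n.
    by move: (L%:R : R) => Lr; lra.
  rewrite -natr1; nra.
(* Precision [h] remains below 1/8 after a loss of [k], and [h'] falls back to [h] after such a
   loss. *)
pose h : R := (8 * k.+1%:R)^-1; pose h' := h / k.+1%:R; pose c := h' ^+ 2 / 2.
have k10 : 0 < k.+1%:R :> R by rewrite ltr0n.
have kk1 : k%:R <= k.+1%:R :> R by rewrite ler_nat.
have h_gt0 : 0 < h by rewrite invr_gt0 mulr_gt0.
have h_small : 8 * (k%:R * h) <= 1.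
  by rewrite mulrA /h ler_pdivrMr ?mulr_gt0// mul1r ler_pM2l.
have h'_gt0 : 0 < h' by rewrite divr_gt0.
have h'_small : k%:R * h' <= h.
  by rewrite /h' mulrA ler_pdivrMr// mulrC ler_pM2l.
have k11 : 1 <= k.+1%:R :> R by rewrite ler1n.
have h1 : h <= 1 by rewrite invf_le1 ?mulr_gt0//; lra.
have h'1 : h' <= 1 by rewrite ler_pdivrMr// mul1r (le_trans h1)// ler1n.
have c_gt0 : 0 < c by rewrite divr_gt0// exprn_gt0.
have h'2 : h' ^+ 2 <= 1 by rewrite exprn_ile1// ltW.
have c_le1 : c <= 1 by rewrite /c; lra.
pose b := cnorm (beta i).
pose eta := sg / (6 * expR (b * m) * (b + 1)).
have eb : 1 <= expR (b * m) by rewrite -expR0 ler_expR mulr_ge0// ltW.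
have den0 : 0 < 6 * expR (b * m) * (b + 1) by rewrite !mulr_gt0 ?expR_gt0 ?addr_gt0.
have eta_gt0 : 0 < eta by rewrite divr_gt0.
have eta2 : 3 * expR (b * m) * (b * (2 * eta)) <= sg.
  rewrite (_ : _ * (b * _) = sg * (b / (b + 1))); last first.
    by rewrite /eta; field; rewrite !gt_eqF ?expR_gt0 ?addr_gt0.
  by rewrite ler_piMr ?(ltW sg_gt0)// ler_pdivrMr ?addr_gt0//; lra.
have eta1 : b * (2 * eta) <= 1.
  have p0 : 0 <= b * (2 * eta).
    by apply: mulr_ge0; [exact: ltW|apply: mulr_ge0 => //; exact: ltW].
  apply: le_trans (le_trans eta2 sg_le1); rewrite ler_peMl//; lra.
pose E := expR (L%:R * B * m); have E0 : 0 <= E by exact: expR_ge0.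
(* A single integer serves both initial labels, those of [l] and those of the last point. *)
pose k0 := Num.Def.archi_bound (2 * m / eta + 2 * E / h).
have t1 : 0 <= 2 * m / eta by apply: divr_ge0; [exact: mulr_ge0|exact: ltW].
have t2 : 0 <= 2 * E / h by apply: divr_ge0; [exact: mulr_ge0|exact: ltW].
have k0P : 2 * m / eta + 2 * E / h < k0%:R by apply: archi_boundP; rewrite addr_ge0.
have k0_big1 : 2 * m <= k0%:R * eta by rewrite -ler_pdivrMr//; move: t2 k0P; lra.
have k0_big2 : 2 * E <= k0%:R * h by rewrite -ler_pdivrMr//; move: t1 k0P; lra.
(* The finite word is continued by the letter [i]; the cover only looks at its first [L * M]
   letters. *)
pose cs M v := centers beta i m kappa sg L k k0 D h c eta E (nth i v) M.
pose r M := radius beta i m kappa sg L h M.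
pose r0 := 3 * expR m * (Ca * h).
have r00 : 0 < r0 by apply: mulr_gt0; [rewrite mulr_gt0 ?expR_gt0|exact: mulr_gt0].
have kC : (k.+1 ^ 4 <= Q ^ D)%N.
  rewrite k1 /Q -!expnM (_ : (L * 4 = 16 * e * D)%N)//.
  by rewrite /L; clear; lia.
exists cs, r, (r0 + k0.+1%:R ^+ 6 * r0), c, L, D.
have K60 : 0 < k0.+1%:R ^+ 6 :> R by rewrite exprn_gt0.
have r0K : 0 < k0.+1%:R ^+ 6 * r0 by rewrite mulr_gt0.
have q2 : 0 < 2 * Q%:R ^+ 2 :> R by lra.
have kLM M : kappa ^+ (L * M) <= (2 * Q%:R ^+ 2)^-1 ^+ M.
  rewrite exprM; apply: lerXn2r; rewrite ?nnegrE.
  - by rewrite exprn_ge0 ?(ltW kappa_gt0).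
  - by rewrite invr_ge0 ltW.
  - by move: hD; rewrite -exprM /L mulnA.
split; first by split => //; rewrite addr_gt0.
- apply: filterS (ae_few_blocks D hP he) => om [N hN]; exists N => M NM.
  have rM : r M = r0 * kappa ^+ (L * M) by [].
  have r0M : 0 <= r M by rewrite /r radius_ge0.
  split => //.
    rewrite rM (@le_trans _ _ (r0 * 2^-1 ^+ M))//.
      rewrite ler_pM2l// (le_trans (kLM M))//; apply: lerXn2r; rewrite ?nnegrE ?invr_ge0 ?(ltW q2)//.
      by rewrite lef_pV2 ?posrE// ler_peMr.
    by rewrite ler_wpM2r ?exprn_ge0// lerDl ltW.
  have nn : (D * not_nice i L (nth i (prefix_word om (L * M))) M <= M)%N.
    apply: leq_trans (ltnW (hN M NM)); rewrite leq_mul2l; apply/orP; right.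
    by apply: (leq_trans (not_nice_le _ _ _ _)); rewrite prefix_word_nth.
  have sz := size_centers beta m kappa sg k0 h c eta E Q0 kC nn.
  apply: (@le_trans _ _ (k0.+1%:R ^+ 6 * r0)); last by rewrite lerDr ltW.
  apply: (le_trans (ler_wpM2r r0M sz)).
  rewrite rM mulrACA ler_piMr ?(ltW r0K)//.
  apply: (@le_trans _ _ ((2 * Q%:R ^+ 2) ^+ M * (2 * Q%:R ^+ 2)^-1 ^+ M)).
    by rewrite ler_wpM2l// exprn_ge0// ltW.
  by rewrite -exprMn divff ?expr1n// gt_eqF.
move=> om lam w M lam0 reg x1 xE nbox; rewrite leqNgt; apply/negP => few.
apply: nbox; set om' := nth i (prefix_word om (L * M)).
have ee j : (j < L * M)%N -> om' j = om j by move=> ?; exact: nth_prefix_word.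
apply: (@centers_cover R I beta i m kappa sg B m_ge0 (ltW kappa_lt1) kappa_gt0 sg_gt0 sg_le1
  beta_le beta_i L k k0 D h h' c eta E k_big h_gt0 h_small (ltW h'_gt0) h'_small (lexx _) c_le1
  eta_gt0 eta1 eta2 k0_big1 k0_big2 om' M lam w) => //.
  by split; rewrite //= (orbit_pt_eq _ _ _ ee).
apply: leq_ltn_trans few; rewrite leq_mul2l; apply/orP; right.
exact: bad_blocks_le.
Qed.

End ErdosKahane.

(** * Covers of the curves on which a multiplier is real *)

Section CurveCover.
Context {R : realType} (b : cplx R) (m : R).
Hypotheses (b0 : b != (0, 0)) (m_ge0 : 0 <= m).
Implicit Types (l lam : cplx R).

(** On these curves [sin] vanishes at the imaginary part of [b * l]. Two such parts at distance at
    most 1 therefore coincide, so a label at scale 1 is exact there. Only the real part is resolved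
    at scale [2 ^ - M], which takes [O(2 ^ M)] boxes. *)
Lemma curve_cover : exists (cs : nat -> seq (cplx R)) (r : nat -> R) (C : R),
  [/\ 0 < C, forall M, [/\ 0 <= r M, r M <= C * 2^-1 ^+ M & (size (cs M))%:R * r M <= C] &
    forall M lam, lam != (0, 0) -> cnorm (clog lam) <= m ->
      (cexp (cmul b (clog lam))).2 = 0 -> boxes (cs M) (r M) lam].
Proof.
have nb : 0 < cnorm b by rewrite cnorm_gt0.
pose A := 2 * (cnorm b * m).
have A0 : 0 <= A by rewrite !mulr_ge0// ltW.
pose K := Num.Def.archi_bound A.
have AK : A <= K%:R by rewrite ltW// archi_boundP.
pose lab M l := (mod_label (2^-1 ^+ M) (K * 2 ^ M) (cmul b l).1,
                 mod_label 1 K (cmul b l).2).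
pose Z l := cnorm l <= m /\ (cexp (cmul b l)).2 = 0.
pose cs M := [seq cexp (xget (0, 0) [set l | Z l /\ lab M l = t]) |
                t <- enum {: 'I_(K * 2 ^ M).+1 * 'I_K.+1}].
pose r0 := 3 * expR m / cnorm b.
have r00 : 0 < r0 by rewrite divr_gt0// mulr_gt0// expR_gt0.
have KK : 1 <= K.+1%:R ^+ 2 :> R by rewrite exprn_ege1// ler1n.
exists cs, (fun M => r0 * 2^-1 ^+ M), (K.+1%:R ^+ 2 * r0); split.
- by rewrite mulr_gt0// exprn_gt0.
- move=> M; split; first by rewrite mulr_ge0 ?exprn_ge0// ltW.
    by rewrite ler_wpM2r ?exprn_ge0// ler_peMl// ltW.
  rewrite size_map -cardE card_prod !card_ord mulrCA mulrC ler_wpM2r ?(ltW r00)//.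
  rewrite exprVn ler_pdivrMr ?exprn_gt0// -!natrX -natrM ler_nat.
  rewrite mulnC -mulnn -mulnA leq_mul2l /= mulSn -add1n leq_add2r.
  by rewrite expn_gt0.
move=> M lam lam0 lm lz; set l := clog lam in lm lz *.
have Zl : Z l by [].
have [] := xgetPex (0, 0) (ex_intro _ l (conj Zl erefl) : exists l', Z l' /\ lab M l' = lab M l).
set l' := xget _ _ => -[lm' lz'] e.
exists (cexp l'); first by apply/mapP; exists (lab M l); rewrite ?mem_enum.
have bnd (x : cplx R) : cnorm x <= m -> cnorm (cmul b x) <= cnorm b * m.
  by move=> xm; rewrite cnormM ler_pM2l.
have h2 : 0 < 2^-1 ^+ M :> R by rewrite exprn_gt0.
case: e => e1 e2.
have d1 : `|(cmul b l').1 - (cmul b l).1| <= 2^-1 ^+ M.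
  apply: mod_label_eq h2 _ e1; rewrite natrM natrX exprVn mulfK ?expf_neq0//.
  apply: le_trans AK; apply: (le_trans (ler_normB _ _)).
  have := le_trans (ler_re_cnorm _) (bnd _ lm); have := le_trans (ler_re_cnorm _) (bnd _ lm').
  rewrite /A; lra.
have d2 : `|(cmul b l').2 - (cmul b l).2| <= 1.
  apply: mod_label_eq ltr01 _ e2; rewrite mulr1.
  apply: le_trans AK; apply: (le_trans (ler_normB _ _)).
  have := le_trans (ler_im_cnorm _) (bnd _ lm); have := le_trans (ler_im_cnorm _) (bnd _ lm').
  rewrite /A; lra.
have sin0 (x : cplx R) : (cexp x).2 = 0 -> sin x.2 = 0.
  by move=> /eqP; rewrite mulf_eq0 expR_eq0 => /eqP.
have d20 : (cmul b l').2 - (cmul b l).2 = 0.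
  have := abs_sin_ge d2; rewrite sinB (sin0 _ lz) (sin0 _ lz') mul0r mulr0 subr0 normr0.
  by move=> h; apply/eqP; rewrite -normr_le0; lra.
have dl : cnorm (csub l l') <= 2^-1 ^+ M / cnorm b.
  rewrite ler_pdivlMr// mulrC -cnormM cmulBr cnorm_subC.
  by rewrite (le_trans (cnorm_le_sum _))//= d20 normr0 addr0.
have : cnorm (csub lam (cexp l')) <= r0 * 2^-1 ^+ M.
  rewrite -{1}(clogK lam0) (le_trans (cexp_lip lm lm'))//.
  rewrite (_ : r0 * _ = 3 * expR m * (2^-1 ^+ M / cnorm b)); last by rewrite /r0; ring.
  by rewrite ler_wpM2l// mulr_ge0// expR_ge0.
by move=> dr; split; [have := ler_re_cnorm (csub lam (cexp l'))|
  have := ler_im_cnorm (csub lam (cexp l'))]; rewrite /= => /le_trans; apply.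
Qed.

End CurveCover.

(** * Fourier transforms of random sums *)

Section IndependentPhases.
Context {R : realType} {d : measure_display} {T : measurableType d}.
Context (Q : probability T R) (u : nat -> T -> nat) (k : nat -> nat) (p : nat -> nat -> R).
Hypotheses (mu : forall n, measurable_fun setT (u n))
  (law : forall n j, (j < k n)%N -> Q (u n @^-1` [set j]) = (p n j)%:E)
  (psum : forall n, \sum_(j < k n) p n j = 1)
  (indep : mutually_independent Q u).

Lemma measurable_preimage n (A : set nat) : measurable (u n @^-1` A).
Proof. by rewrite -[X in measurable X]setTI; apply: mu. Qed.

Lemma integrable_bounded1 (D : set T) (f : T -> R) : measurable D ->
  measurable_fun setT f -> (forall x, `|f x| <= 1) -> Q.-integrable D (EFin \o f).
Proof.
move=> mD mf f1; apply: measurable_bounded_integrable => //.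
- by apply: le_lt_trans (probability_le1 Q mD) _; rewrite ltry.
- exact: measurable_funTS.
- by exists 1; split=> // M M1 x _ /=; rewrite (le_trans (f1 x))// ltW.
Qed.

Lemma Rintegral_split_tail (D : set T) (f : T -> R) n m : measurable D ->
  measurable_fun setT f -> (forall x, `|f x| <= 1) ->
  Rintegral Q D f = \sum_(j < m) Rintegral Q (D `&` u n @^-1` [set nat_of_ord j]) f +
    Rintegral Q (D `&` u n @^-1` [set j | (m <= j)%N]) f.
Proof.
move=> mD mf f1; elim: m => [|m ->].
  rewrite big_ord0 add0r; congr (Rintegral Q _ f).
  by apply/seteqP; split => [x Dx|x []//]; split.
rewrite big_ord_recr /= -addrA; congr (_ + _).
rewrite -Rintegral_setU.
- congr (Rintegral Q _ f); apply/seteqP; split => x /=.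
    move=> [Dx]; rewrite leq_eqVlt => /orP[/eqP <-|h]; [left|right]; split=> //.
  by case=> -[Dx]; [move=> ->|move=> /ltnW]; split.
- by apply: measurableI => //; exact: measurable_preimage.
- by apply: measurableI => //; exact: measurable_preimage.
- apply: integrable_bounded1 => //; apply: measurableU; apply: measurableI => //;
    exact: measurable_preimage.
- apply/disj_setPS => x /= [[_ ->] [_]]; by rewrite ltnn.
Qed.

(** The prescribed probabilities of the indices below [k n] already sum to 1; this is the split of
    the constant function 1. *)
Lemma tail_null n : Q (u n @^-1` [set j | (k n <= j)%N]) = 0%E.
Proof.
have m1 : measurable_fun setT (fun _ : T => 1 : R) by exact: measurable_cst.
have n1 (x : T) : `|(1 : R)| <= 1 by rewrite normr1.
have := Rintegral_split_tail n (k n) measurableT m1 n1.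
rewrite Rintegral_cst// [X in 1 * X](_ : _ = 1) ?mul1r; last exact: (congr1 fine (probability_setT Q)).
rewrite (eq_bigr (fun j : 'I_(k n) => p n j)); last first.
  move=> j _; rewrite setTI Rintegral_cst; last exact: measurable_preimage.
  by rewrite mul1r; exact: (congr1 fine (law (ltn_ord j))).
rewrite psum setTI Rintegral_cst; last exact: measurable_preimage.
rewrite mul1r -[X in X = _]addr0 => /addrI/esym h.
rewrite -[LHS]fineK ?h// fin_num_measure//; exact: measurable_preimage.
Qed.

Lemma Rintegral_split (D : set T) (f : T -> R) n : measurable D ->
  measurable_fun setT f -> (forall x, `|f x| <= 1) ->
  Rintegral Q D f = \sum_(j < k n) Rintegral Q (D `&` u n @^-1` [set nat_of_ord j]) f.
Proof.
move=> mD mf f1; rewrite (Rintegral_split_tail n (k n))// [X in _ + X](_ : _ = 0) ?addr0//.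
have mt : measurable (D `&` u n @^-1` [set j | (k n <= j)%N]).
  by apply: measurableI => //; exact: measurable_preimage.
rewrite /Rintegral null_set_integral//.
  by apply/measurable_EFinP; exact: measurable_funTS.
apply/eqP; rewrite -measure_le0 -(tail_null n) le_measure ?inE//.
exact: measurable_preimage.
Qed.

Context (a : nat -> nat -> R).

Definition phase N (x : T) : R := \sum_(n < N) a n (u n x).

Definition char_fun n : cplx R :=
  (\sum_(j < k n) p n j * cos (a n j), \sum_(j < k n) p n j * sin (a n j)).

Fixpoint char_prod N : cplx R :=
  if N is N'.+1 then cmul (char_prod N') (char_fun N') else (1, 0).

Lemma measurable_phase N : measurable_fun setT (phase N).
Proof.
rewrite /phase; elim: N => [|N IH].
  by under eq_fun do rewrite big_ord0; exact: measurable_cst.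
under eq_fun do rewrite big_ord_recr /=.
by apply: measurable_funD => //; apply: measurableT_comp (mu N).
Qed.

Lemma measurable_cos_phase N : measurable_fun setT (fun x => cos (phase N x)).
Proof.
have m : measurable_fun [set: R] (@cos R).
  by apply: continuous_measurable_fun; exact: continuous_cos.
exact: measurableT_comp m (measurable_phase N).
Qed.

Lemma measurable_sin_phase N : measurable_fun setT (fun x => sin (phase N x)).
Proof.
have m : measurable_fun [set: R] (@sin R).
  by apply: continuous_measurable_fun; exact: continuous_sin.
exact: measurableT_comp m (measurable_phase N).
Qed.

(** The event [D] constrains only coordinates from [N] on, so the induction closes: splitting [D] by
    the value of [u N] gives events of the same kind for the shorter phase, and independence is used
    on events alone. *)
Lemma Rintegral_phase N (s : seq nat) (A : nat -> set nat) : uniq s ->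
  (forall n, n \in s -> (N <= n)%N) ->
  let D := \bigcap_(n in [set n | n \in s]) (u n @^-1` A n) in
  Rintegral Q D (fun x => cos (phase N x)) = (char_prod N).1 * fine (Q D) /\
  Rintegral Q D (fun x => sin (phase N x)) = (char_prod N).2 * fine (Q D).
Proof.
elim: N s A => [|N IH] s A us hs D.
  have mD : measurable D.
    apply: bigcap_measurableType => n _; exact: measurable_preimage.
  have ph0 x : phase 0 x = 0 by rewrite /phase big_ord0.
  split; [under eq_Rintegral => x _ do rewrite ph0 cos0|
          under eq_Rintegral => x _ do rewrite ph0 sin0];
    by rewrite Rintegral_cst.
have mD : measurable D.
  apply: bigcap_measurableType => n _; exact: measurable_preimage.
have Ns : N \notin s by apply/negP => /hs; rewrite ltnn.
pose Dj (j : nat) := D `&` u N @^-1` [set j].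
pose A' j n := if n == N then [set j] else A n.
have DjE j : Dj j = \bigcap_(n in [set n | n \in N :: s]) (u n @^-1` A' j n).
  apply/seteqP; split => x /=.
    move=> [Dx xj] n; rewrite /= inE /A'; case: eqP => [-> _ //|_ /= ns].
    exact: Dx.
  move=> h; split; last by have := h N; rewrite /= inE eqxx /A' eqxx; apply.
  move=> n /= ns; have := h n; rewrite /= inE ns orbT /A'.
  by case: eqP => [nN|_]; [move: ns; rewrite nN (negbTE Ns)|apply].
have us' : uniq (N :: s) by rewrite /= Ns.
have hs' n : n \in N :: s -> (N <= n)%N.
  by rewrite inE => /orP[/eqP ->//|/hs/ltnW].
have mDj j : measurable (Dj j).
  by apply: measurableI => //; exact: measurable_preimage.
have QDj j : (j < k N)%N -> fine (Q (Dj j)) = p N j * fine (Q D).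
  move=> jk; rewrite DjE indep// big_cons /A' eqxx law//.
  rewrite (eq_big_seq (fun n => Q (u n @^-1` A n))); last first.
    by move=> n ns; case: eqP => // nN; move: ns; rewrite nN (negbTE Ns).
  by rewrite -indep// fineM ?fin_num_measure.
have phS j x : Dj j x -> phase N.+1 x = phase N x + a N j.
  by move=> [_ /= xj]; rewrite /phase big_ord_recr /= xj.
have ic j : Q.-integrable (Dj j) (EFin \o (fun x => cos (phase N x))).
  apply: integrable_bounded1 => // [|x]; [exact: measurable_cos_phase|exact: cos_max].
have is_ j : Q.-integrable (Dj j) (EFin \o (fun x => sin (phase N x))).
  apply: integrable_bounded1 => // [|x]; [exact: measurable_sin_phase|exact: sin_max].
have IHj j : Rintegral Q (Dj j) (fun x => cos (phase N x)) = (char_prod N).1 * fine (Q (Dj j)) /\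
    Rintegral Q (Dj j) (fun x => sin (phase N x)) = (char_prod N).2 * fine (Q (Dj j)).
  by rewrite DjE; exact: IH.
have lin j (s1 s2 : R) : (j < k N)%N ->
    Rintegral Q (Dj j) (fun x => s1 * cos (phase N x) + s2 * sin (phase N x)) =
    p N j * (s1 * (char_prod N).1 + s2 * (char_prod N).2) * fine (Q D).
  move=> jk; have [i1 i2] := IHj j.
  rewrite RintegralD//.
  - by rewrite !RintegralZl// i1 i2 QDj//; ring.
  - exact: (integrableZl (mDj j) s1 (ic j)).
  - exact: (integrableZl (mDj j) s2 (is_ j)).
split.
- rewrite (@Rintegral_split D _ N)//; last 2 first.
  + exact: measurable_cos_phase.
  + by move=> x; exact: cos_max.
  rewrite (eq_bigr (fun j : 'I_(k N) => p N j * (cos (a N j) * (char_prod N).1 +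
     (- sin (a N j)) * (char_prod N).2) * fine (Q D))); last first.
    move=> j _; rewrite -lin//; apply: eq_Rintegral => x; rewrite inE => xj.
    by rewrite (phS _ _ xj) cosD; ring.
  rewrite -mulr_suml; congr (_ * _); rewrite /= !mulr_sumr -sumrB.
  by apply: eq_bigr => j _; ring.
- rewrite (@Rintegral_split D _ N)//; last 2 first.
  + exact: measurable_sin_phase.
  + by move=> x; exact: sin_max.
  rewrite (eq_bigr (fun j : 'I_(k N) => p N j * (sin (a N j) * (char_prod N).1 +
     cos (a N j) * (char_prod N).2) * fine (Q D))); last first.
    move=> j _; rewrite -lin//; apply: eq_Rintegral => x; rewrite inE => xj.
    by rewrite (phS _ _ xj) sinD; ring.
  rewrite -mulr_suml; congr (_ * _); rewrite /= !mulr_sumr -big_split.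
  by apply: eq_bigr => j _ /=; ring.
Qed.

Lemma char_prodE N :
  (Rintegral Q setT (fun x => cos (phase N x)), Rintegral Q setT (fun x => sin (phase N x))) =
  char_prod N.
Proof.
have := @Rintegral_phase N [::] (fun=> setT) isT; rewrite /=.
rewrite (_ : \bigcap_(n in _) _ = setT); last by apply/seteqP; split.
move=> [//| -> ->]; rewrite [fine _](_ : _ = 1); last exact: (congr1 fine (probability_setT Q)).
by rewrite !mulr1 -surjective_pairing.
Qed.

Lemma cnorm_char_fun n : (forall j, (j < k n)%N -> 0 <= p n j) -> cnorm (char_fun n) <= 1.
Proof.
move=> p0; rewrite -(psum n) /char_fun.
elim: (k n) p0 => [|K IH] p0; first by rewrite !big_ord0 cnorm0.
rewrite !big_ord_recr /=.
apply: (le_trans (cnormD (\sum_(j < K) p n j * cos (a n j), \sum_(j < K) p n j * sin (a n j))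
   (p n K * cos (a n K), p n K * sin (a n K)))).
apply: lerD; first by apply: IH => j jK; apply: p0; exact: ltnW.
rewrite (_ : (_, _) = cmul (p n K, 0) (cos (a n K), sin (a n K))); last first.
  by rewrite /cmul /=; congr pair; ring.
rewrite cnormM cnorm_cis mulr1 (le_trans (cnorm_le_sum _))//= normr0 addr0 ger0_norm//.
exact: p0.
Qed.

End IndependentPhases.

Lemma foldr_caddE {R : realType} (s : seq (cplx R)) :
  foldr (@cadd R) (0, 0) s = (\sum_(z <- s) z.1, \sum_(z <- s) z.2).
Proof. by elim: s => [|z s IH] /=; rewrite ?big_nil// IH !big_cons. Qed.

Lemma partial_sumE {R : realType} {I : finType} (lam : I -> cplx R)
    (t : I -> nat -> cplx R) (om : nat -> I) (v : nat -> nat) N :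
  partial_sum lam t om v N =
  (\sum_(n < N) (cmul (lin_prod lam om n) (t (om n) (v n))).1,
   \sum_(n < N) (cmul (lin_prod lam om n) (t (om n) (v n))).2).
Proof.
have e : iota 0 N = index_iota 0 N by rewrite /index_iota subn0.
by rewrite /partial_sum foldr_caddE !big_map e !big_mkord.
Qed.

Lemma cnorm_lin_prod {R : realType} {I : finType} (lam : I -> cplx R) (kappa : R)
    (om : nat -> I) n : (forall i, cnorm (lam i) <= kappa) ->
  cnorm (lin_prod lam om n) <= kappa ^+ n.
Proof.
move=> h; elim: n => [|n IH] /=; first by rewrite cnorm1.
by rewrite cnormM exprSr ler_pM// cnorm_ge0.
Qed.

Lemma cvg_dominated_series {R : realType} (f : R ^nat) (C kappa : R) :
  0 <= C -> 0 <= kappa -> kappa < 1 -> (forall n, `|f n| <= C * kappa ^+ n) ->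
  cvgn (fun N => \sum_(n < N) f n).
Proof.
move=> C0 k0 k1 h.
rewrite (_ : (fun N => _) = series f); last first.
  by apply/funext => N; rewrite /series /= big_mkord.
apply: normed_cvg; apply: (@series_le_cvg _ _ (geometric C kappa)) => [n|n|n|].
- by rewrite /= normr_ge0.
- by rewrite /= mulr_ge0// exprn_ge0.
- exact: h.
- by apply: is_cvg_geometric_series; rewrite ger0_norm.
Qed.

Section FourierLimit.
Context {R : realType} {I : finType} (lam : I -> cplx R) (om : nat -> I) (k : I -> nat)
  (t : I -> nat -> cplx R) (p : I -> nat -> R) (kappa : R).
Hypotheses (kappa_ge0 : 0 <= kappa) (kappa_lt1 : kappa < 1)
  (lam_le : forall i, cnorm (lam i) <= kappa) (hp : prob_vector k p).
Context {d : measure_display} {T : measurableType d} (Q : probability T R)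
  (u : nat -> T -> nat).
Hypotheses (mu : forall n, measurable_fun setT (u n))
  (law : forall n j, (j < k (om n))%N -> Q (u n @^-1` [set j]) = (p (om n) j)%:E)
  (indep : mutually_independent Q u).
Context (X : {mfun T >-> cplx R}).
Hypothesis hX : forall x, X x = random_sum lam t om (fun n => u n x).

Definition freq_phase (xi : cplx R) n j : R :=
  let z := cmul (lin_prod lam om n) (t (om n) j) in
  2 * pi * (z.1 * xi.1 + z.2 * xi.2).

Lemma cvg_partial_sum (v : nat -> nat) : (forall n, (v n < k (om n))%N) ->
  cvgn (fun N => (partial_sum lam t om v N).1) /\
  cvgn (fun N => (partial_sum lam t om v N).2).
Proof.
move=> hv.
pose C := \sum_i \sum_(j < k i) cnorm (t i j).
have C0 : 0 <= C by apply: sumr_ge0 => i _; apply: sumr_ge0 => j _; exact: cnorm_ge0.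
have tC i j : (j < k i)%N -> cnorm (t i j) <= C.
  move=> jk; rewrite /C (bigD1 i)//= (bigD1 (Ordinal jk))//= -addrA lerDl addr_ge0//.
    by apply: sumr_ge0 => *; exact: cnorm_ge0.
  by apply: sumr_ge0 => *; apply: sumr_ge0 => *; exact: cnorm_ge0.
have tn n : cnorm (cmul (lin_prod lam om n) (t (om n) (v n))) <= C * kappa ^+ n.
  by rewrite cnormM mulrC ler_pM ?cnorm_ge0 ?tC// cnorm_lin_prod.
pose z n := cmul (lin_prod lam om n) (t (om n) (v n)).
have -> : (fun N => (partial_sum lam t om v N).1) = (fun N => \sum_(n < N) (z n).1).
  by apply/funext => N; rewrite partial_sumE.
have -> : (fun N => (partial_sum lam t om v N).2) = (fun N => \sum_(n < N) (z n).2).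
  by apply/funext => N; rewrite partial_sumE.
split.
- apply: (@cvg_dominated_series _ (fun n => (z n).1) C kappa) => // n.
  exact: le_trans (ler_re_cnorm _) (tn n).
- apply: (@cvg_dominated_series _ (fun n => (z n).2) C kappa) => // n.
  exact: le_trans (ler_im_cnorm _) (tn n).
Qed.

Let psum n : \sum_(j < k (om n)) p (om n) j = 1.
Proof. by have [] := hp (om n). Qed.

(** Off this null set the series converges geometrically, which is all that dominated convergence
    needs. *)
Lemma ae_range : {ae Q, forall x, forall n, (u n x < k (om n))%N}.
Proof.
apply: ae_foralln => n; exists (u n @^-1` [set j | (k (om n) <= j)%N]); split.
- exact: measurable_preimage.
- exact: (@tail_null _ _ _ Q u (fun n => k (om n)) (fun n => p (om n))).
by move=> x /= /negP; rewrite -leqNgt.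
Qed.

Context (xi : cplx R).
Let dotX (x : T) : R := 2 * pi * ((X x).1 * xi.1 + (X x).2 * xi.2).

Lemma cvg_phase x : (forall n, (u n x < k (om n))%N) ->
  phase u (freq_phase xi) N x @[N --> \oo] --> dotX x.
Proof.
move=> hx; have [c1 c2] := cvg_partial_sum hx.
have -> : (fun N => phase u (freq_phase xi) N x) = (fun N =>
    2 * pi * ((partial_sum lam t om (u ^~ x) N).1 * xi.1 +
              (partial_sum lam t om (u ^~ x) N).2 * xi.2)).
  apply/funext => N; rewrite partial_sumE /phase /freq_phase /=.
  by rewrite -mulr_sumr big_split /= !mulr_suml.
rewrite /dotX hX /random_sum /=.
apply: cvgMr; apply: cvgD; apply: cvgMl; [exact: c1|exact: c2].
Qed.

Lemma measurable_dotX : measurable_fun setT dotX.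
Proof.
have m1 : measurable_fun setT (fun x => (X x).1).
  by apply: measurableT_comp => //; exact: measurable_fst.
have m2 : measurable_fun setT (fun x => (X x).2).
  by apply: measurableT_comp => //; exact: measurable_snd.
by apply: measurable_funM => //; apply: measurable_funD; apply: measurable_funM.
Qed.

Lemma Rintegral_cvg (g : R -> R) : continuous g -> (forall y, `|g y| <= 1) ->
  Rintegral Q setT (fun x => g (phase u (freq_phase xi) N x)) @[N --> \oo] -->
  Rintegral Q setT (g \o dotX).
Proof.
move=> cg g1.
have mg : measurable_fun setT g by exact: continuous_measurable_fun.
have mN N : measurable_fun setT (fun x => g (phase u (freq_phase xi) N x)).
  by apply: measurableT_comp mg _; exact: measurable_phase.
have mX : measurable_fun setT (g \o dotX).
  by apply: measurableT_comp mg _; exact: measurable_dotX.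
pose f_ N := EFin \o (fun x => g (phase u (freq_phase xi) N x)).
have A1 N : measurable_fun setT (f_ N) by apply/measurable_EFinP.
have A2 : measurable_fun setT (EFin \o (g \o dotX)) by apply/measurable_EFinP.
have A3 : {ae Q, forall x, setT x -> f_ ^~ x @ \oo --> (EFin \o (g \o dotX)) x}.
  apply: filterS ae_range => x hx _.
  have cx : g (phase u (freq_phase xi) N x) @[N --> \oo] --> g (dotX x).
    by apply: continuous_cvg; [exact: cg|exact: cvg_phase].
  by apply: cvg_EFin; [exact: nearW|exact: cx].
pose o : T -> \bar R := EFin \o (fun=> 1).
have A4 : Q.-integrable setT o.
  by apply: integrable_bounded1 => // x; rewrite normr1.
have A5 : {ae Q, forall x n, setT x -> (`|f_ n x| <= o x)%E}.
  by apply: aeW => x N _; rewrite /f_ /o /= lee_fin.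
have [if_ _ h] := dominated_convergence measurableT A1 A2 A3 A4 A5.
apply: fine_cvg; rewrite fineK//; exact: integrable_fin_num.
Qed.

Lemma Rintegral_distribution (g : R -> R) : continuous g -> (forall y, `|g y| <= 1) ->
  Rintegral (distribution Q X) setT (fun z => g (2 * pi * (z.1 * xi.1 + z.2 * xi.2))) =
  Rintegral Q setT (g \o dotX).
Proof.
move=> cg g1.
have mg : measurable_fun setT g by exact: continuous_measurable_fun.
have mz : measurable_fun setT (fun z : cplx R => g (2 * pi * (z.1 * xi.1 + z.2 * xi.2))).
  have m1 : measurable_fun setT (fun z : cplx R => z.1) by exact: measurable_fst.
  have m2 : measurable_fun setT (fun z : cplx R => z.2) by exact: measurable_snd.
  apply: measurableT_comp mg _.
  by apply: measurable_funM => //; apply: measurable_funD; apply: measurable_funM.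
rewrite /Rintegral; congr fine; apply: integral_distribution.
  by apply/measurable_EFinP.
apply: (@integrable_bounded1 _ _ _ Q setT (g \o dotX)) => // [|x]; last exact: g1.
by apply: measurableT_comp mg _; exact: measurable_dotX.
Qed.

Lemma fourier_abs_le (b : R) N0 : 0 <= b ->
  (forall N, (N0 <= N)%N ->
    cnorm (char_prod (fun n => k (om n)) (fun n => p (om n)) (freq_phase xi) N) <= b) ->
  fourier_abs (distribution Q X) xi <= b.
Proof.
move=> b0 hb.
rewrite /fourier_abs cnorm_le//= /fourier_re /fourier_im.
rewrite (@Rintegral_distribution cos)//; last 2 first.
- exact: continuous_cos.
- exact: cos_max.
rewrite (@Rintegral_distribution sin)//; last 2 first.
- exact: continuous_sin.
- exact: sin_max.
have c1 := Rintegral_cvg (@continuous_cos R) (@cos_max R).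
have c2 := Rintegral_cvg (@continuous_sin R) (@sin_max R).
apply: (@cvgr_to_le _ \oo _ _ _ _ _ (cvgD (cvgM c1 c1) (cvgM c2 c2))).
exists N0 => // N /= NN; have := hb N NN.
rewrite -(char_prodE mu law psum indep) cnorm_le//.
Qed.

End FourierLimit.

Section CharProdBounds.
Context {R : realType} (k : nat -> nat) (p : nat -> nat -> R) (a : nat -> nat -> R).
Hypotheses (psum : forall n, \sum_(j < k n) p n j = 1)
  (p_ge0 : forall n j, (j < k n)%N -> 0 <= p n j).

(* [1 - |phi|^2] is the double sum of [p_j p_j' (1 - cos (a_j - a_j'))]. *)
Lemma cnorm_char_fun_lt n j1 j2 c : (j1 < k n)%N -> (j2 < k n)%N ->
  c <= 1 - cos (a n j1 - a n j2) ->
  cnorm (char_fun k p a n) <= Num.sqrt (1 - p n j1 * p n j2 * c).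
Proof.
move=> h1 h2 hc; apply: ler_wsqrtr; rewrite /char_fun /=.
set Sc := \sum_(j < k n) _ * cos _; set Ss := \sum_(j < k n) _ * sin _.
pose f (j j' : 'I_(k n)) := p n j * p n j' * (1 - cos (a n j - a n j')).
have f0 j j' : 0 <= f j j' by rewrite mulr_ge0 ?subr_ge0 ?cos_le1// mulr_ge0// p_ge0.
have key : 1 - (Sc ^+ 2 + Ss ^+ 2) = \sum_j \sum_j' f j j'.
  have -> : 1 = (\sum_(j < k n) p n j) * (\sum_(j < k n) p n j) :> R by rewrite psum mulr1.
  rewrite !expr2 /Sc /Ss !big_distrlr /= -big_split -sumrB; apply: eq_bigr => j _ /=.
  rewrite -big_split -sumrB; apply: eq_bigr => j' _ /=.
  by rewrite /f cosB; ring.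
have : p n j1 * p n j2 * c <= \sum_j \sum_j' f j j'.
  rewrite (bigD1 (Ordinal h1))//= (bigD1 (Ordinal h2))//= -addrA.
  apply: (@le_trans _ _ (f (Ordinal h1) (Ordinal h2))).
    by rewrite /f /= ler_wpM2l// mulr_ge0// p_ge0.
  by rewrite lerDl addr_ge0// ?sumr_ge0// => *; rewrite sumr_ge0.
by rewrite -key; lra.
Qed.

Lemma cnorm_char_prod_anti N N' : (N <= N')%N ->
  cnorm (char_prod k p a N') <= cnorm (char_prod k p a N).
Proof.
move=> /subnKC <-; elim: (N' - N)%N => [|l IH]; first by rewrite addn0.
rewrite addnS /= cnormM (le_trans _ IH)// ler_piMr ?cnorm_ge0//.
by apply: cnorm_char_fun => // j; exact: p_ge0.
Qed.

(** All factors have modulus at most 1, so each block holding a bad time may be credited with one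
    factor [g]. *)
Lemma cnorm_char_prod_blocks (bad : pred nat) (g : R) L M : 0 <= g -> g <= 1 ->
  (forall n, bad n -> cnorm (char_fun k p a n) <= g) ->
  cnorm (char_prod k p a (L * M)) <=
  g ^+ (\sum_(b < M) has (fun d => bad (b * L + d)%N) (iota 0 L)).
Proof.
move=> g0 g1 hg.
have phi1 n : cnorm (char_fun k p a n) <= 1.
  by apply: cnorm_char_fun => // j; exact: p_ge0.
have block n l : cnorm (char_prod k p a (n + l)) <=
    cnorm (char_prod k p a n) * g ^+ has (fun d => bad (n + d)%N) (iota 0 l).
  elim: l => [|l IH]; first by rewrite addn0 /= mulr1.
  rewrite addnS -[l.+1]addn1 iotaD has_cat /= add0n orbF cnormM.
  case hb : (bad (n + l)%N); last first.
    rewrite orbF (le_trans _ IH)// ler_piMr ?cnorm_ge0//; exact: phi1.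
  rewrite orbT expr1 ler_pM ?cnorm_ge0// ?hg//.
  by apply: cnorm_char_prod_anti; exact: leq_addr.
elim: M => [|M IH]; first by rewrite muln0 big_ord0 /= cnorm1.
rewrite mulnS addnC big_ord_recr /= exprD (mulnC M) (le_trans (block _ _))//.
by rewrite ler_wpM2r// exprn_ge0.
Qed.

End CharProdBounds.

Lemma lin_prod_cpow {R : realType} {I : finType} (beta : I -> cplx R) (lam : cplx R)
    (om : nat -> I) n :
  lin_prod (fun j => cpow lam (beta j)) om n = cexp (cmul (log_sum beta om n) (clog lam)).
Proof.
elim: n => [|n IH] /=.
  by rewrite (_ : cmul (0, 0) _ = (0, 0)) ?cexp0// /cmul /=; congr pair; ring.
by rewrite IH /cpow -cexpD -cmulDl.
Qed.

(** * Power decay of the Fourier transform for parameters outside the covers *)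

Section Decay.
Context {R : realType} {I : finType} (beta : I -> cplx R) (om : nat -> I)
  (lam : cplx R) (i : I) (m kappa B c : R) (L D N0 : nat).
Hypotheses (m_ge0 : 0 <= m) (kappa_gt0 : 0 < kappa) (kappa_lt1 : kappa < 1)
  (lam_m : cnorm (clog lam) <= m)
  (lam_kappa : forall j, cnorm (cexp (cmul (beta j) (clog lam))) <= kappa)
  (beta_le : forall j, cnorm (beta j) <= B) (B_ge0 : 0 <= B)
  (L_gt0 : (0 < L)%N) (D_gt0 : (0 < D)%N) (c_gt0 : 0 < c).
Hypothesis many_bad : forall M w, (N0 <= M)%N ->
  1 <= cnorm (orbit_pt beta om (clog lam) w (L * M)) ->
  cnorm (orbit_pt beta om (clog lam) w (L * M)) <= expR (L%:R * B * m) ->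
  (M <= D * bad_count beta i L c om (clog lam) w M)%N.

Local Notation orb := (orbit_pt beta om (clog lam)).

Lemma orbit_back w n : cnorm (orb w n) <= expR (L%:R * B * m) * cnorm (orb w (n + L)).
Proof.
rewrite (orbit_pt_move _ _ _ _ (n + L)%N) cnormM ler_wpM2r ?cnorm_ge0//.
rewrite (le_trans (cnorm_cexp_le _))// ler_expR cnormM ler_pM ?cnorm_ge0//.
by rewrite cnorm_subC; exact: log_sum_dist.
Qed.

(** [M] is the first index after which the next block end lies below 1. One block changes the
    modulus by at most the factor [E], which gives both upper bounds and makes [M] at least
    proportional to [ln (cnorm w)]. *)
Lemma orbit_scale w : 1 <= cnorm w -> exists M,
  [/\ 1 <= cnorm (orb w (L * M)), cnorm (orb w (L * M)) <= expR (L%:R * B * m)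
    & cnorm w <= expR (L%:R * B * m) ^+ M.+1].
Proof.
move=> w1; set E := expR _.
have ex : exists M, cnorm (orb w (L * M.+1)) < 1.
  have w0 : 0 < cnorm w by apply: lt_le_trans w1.
  have [n hn] : exists n, kappa ^+ n <= (2 * cnorm w)^-1.
    by apply: exprn_small => //; rewrite ?ltW// invr_gt0 mulr_gt0.
  exists n; apply: (@le_lt_trans _ _ (kappa ^+ n * cnorm w)).
    rewrite (le_trans (cnorm_orbit_pt_le _ _ _ lam_kappa))// ler_wpM2r ?cnorm_ge0//.
    rewrite ler_wiXn2l ?(ltW kappa_gt0) ?(ltW kappa_lt1)//.
    by rewrite (leq_trans (leqnSn n))// leq_pmull.
  have := ler_wpM2r (cnorm_ge0 w) hn; move/le_lt_trans; apply.
  by rewrite invfM -mulrA mulVf ?gt_eqF//; lra.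
have [M hM minM] := ex_minnP ex; exists M.
have h1 : 1 <= cnorm (orb w (L * M)).
  case: M {hM} minM => [_|M minM]; first by rewrite muln0 orbit_pt0.
  by rewrite leNgt; apply/negP => /minM; rewrite ltnn.
have hE : cnorm (orb w (L * M)) <= E.
  rewrite (le_trans (orbit_back _ _))// -[leRHS]mulr1 ler_wpM2l ?expR_ge0//.
  by rewrite addnC -mulnS ltW.
have pw n : cnorm w <= E ^+ n * cnorm (orb w (L * n)).
  elim: n => [|n IH]; first by rewrite muln0 orbit_pt0 mul1r.
  rewrite (le_trans IH)// exprSr -mulrA ler_wpM2l ?exprn_ge0 ?expR_ge0//.
  by rewrite mulnS addnC; exact: orbit_back.
split => //; rewrite (le_trans (pw M))// exprSr ler_wpM2l// exprn_ge0//.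
exact: expR_ge0.
Qed.

Lemma eta_decay {i0 : I} (k : I -> nat) (t : I -> nat -> cplx R) (p : I -> nat -> R)
    (j1 j2 : nat) :
  prob_vector k p -> (j1 < k i)%N -> (j2 < k i)%N -> t i j1 <> t i j2 ->
  eta_in_D2 (om : Omega i0) (fun j => cpow lam (beta j)) k t p.
Proof.
move=> hp h1 h2 ht d T Q u mu law indep X hX.
pose k' n := k (om n); pose p' n := p (om n).
have psum n : \sum_(j < k' n) p' n j = 1 by have [] := hp (om n).
have p0 n j : (j < k' n)%N -> 0 <= p' n j by move=> jk; have [/(_ j jk)/ltW] := hp (om n).
pose dt := csub (t i j1) (t i j2).
have dt0 : 0 < cnorm dt.
  rewrite cnorm_gt0; apply/eqP => -[/eqP e1 /eqP e2]; apply: ht.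
  rewrite [LHS]surjective_pairing [RHS]surjective_pairing.
  by move: e1 e2; rewrite !subr_eq0 => /eqP -> /eqP ->.
(* The maximum with 1/2 keeps [g] positive, so that its logarithm can be taken. *)
pose g := Num.max (1 / 2) (Num.sqrt (1 - p i j1 * p i j2 * c)).
have g0 : 0 < g by rewrite lt_max; apply/orP; left; lra.
have g1 : g < 1.
  rewrite gt_max; apply/andP; split; first lra.
  rewrite -[ltRHS]sqrtr1 ltr_sqrt// ltrBlDr ltrDl.
  by have [hpi _] := hp i; rewrite !mulr_gt0 ?hpi.
pose G := - ln g; have G0 : 0 < G by rewrite oppr_gt0 ln_lt0// g0.
have gX n : g ^+ n = expR (- (G * n%:R)).
  by rewrite -{1}(lnK g0) -expRM_natr /G mulNr opprK.
(* The added 1 keeps the denominator of [sigma] positive when [m] vanishes. *)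
pose E1 := L%:R * B * m + 1.
have E10 : 0 < E1 by rewrite ltr_wpDl ?mulr_ge0.
have Dr : 0 < D%:R :> R by rewrite ltr0n.
pose sigma := G / (D%:R * E1).
have sigma0 : 0 < sigma by rewrite divr_gt0// mulr_gt0.
exists sigma => //.
(* The second factor is [cnorm dt ^ - sigma] and turns [xi] into [w]; the first pays for the [N0]
   initial blocks and for the shift from [M] to [M + 1]. *)
exists (expR (G / D%:R * (N0%:R + 1)) * expR (- sigma * ln (cnorm dt))) => xi xi1.
have xi0 : 0 < cnorm xi by apply: lt_le_trans xi1.
pose w := cmul dt (cconj xi).
have nw : cnorm w = cnorm dt * cnorm xi.
  by rewrite cnormM; congr (_ * _); rewrite /cnorm /cconj /= sqrrN.
have w0 : 0 < cnorm w by rewrite nw mulr_gt0.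
rewrite -mulrA /powR gt_eqF// mulNr -mulNr -expRD -mulrDr -lnM ?posrE// -nw.
set bnd := _ * _.
pose a := freq_phase (fun j => cpow lam (beta j)) om t xi.
have lamk j : cnorm (cpow lam (beta j)) <= kappa by exact: lam_kappa.
have four b N1 : 0 <= b -> (forall N, (N1 <= N)%N -> cnorm (char_prod k' p' a N) <= b) ->
    fourier_abs (distribution Q X) xi <= b.
  exact: (fourier_abs_le (ltW kappa_gt0) kappa_lt1 lamk hp mu law indep hX).
have GD0 : 0 < G / D%:R by rewrite divr_gt0.
case: (ltP (cnorm w) 1) => w1.
  apply: (@le_trans _ _ 1).
    apply: (four 1 0%N) => // N _.
    by have := cnorm_char_prod_anti a psum p0 (leq0n N); rewrite /= cnorm1.
  rewrite -[leLHS]mulr1 ler_pM// -[leLHS]expR0 ler_expR.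
    by rewrite mulr_ge0 ?(ltW GD0)// addr_ge0.
  by rewrite mulNr oppr_ge0 mulr_ge0_le0 ?(ltW sigma0)// ln_le0// ltW.
have [M [M1 ME wE]] := orbit_scale w1.
have lw : ln (cnorm w) <= M.+1%:R * E1.
  apply: (@le_trans _ _ (M.+1%:R * (L%:R * B * m))).
    by rewrite -[leRHS]expRK ler_ln ?posrE ?expR_gt0// expRM_natl.
  by rewrite ler_wpM2l// lerDl.
have bnd_ge : expR (- (G / D%:R * (M%:R - N0%:R))) <= bnd.
  rewrite /bnd -expRD ler_expR.
  have : sigma * ln (cnorm w) <= G / D%:R * M.+1%:R.
    rewrite (_ : G / D%:R * M.+1%:R = sigma * (M.+1%:R * E1)); first by rewrite ler_pM2l.
    by rewrite /sigma; field; rewrite !gt_eqF.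
  by rewrite -natr1; move: (G / D%:R) => GD; lra.
apply: le_trans bnd_ge.
case: (leqP N0 M) => NM; last first.
  apply: (@le_trans _ _ 1).
    apply: (four 1 0%N) => // N _.
    by have := cnorm_char_prod_anti a psum p0 (leq0n N); rewrite /= cnorm1.
  rewrite -[leLHS]expR0 ler_expR -mulrN opprB mulr_ge0 ?(ltW GD0)// subr_ge0 ler_nat.
  exact: ltnW.
have mb := many_bad NM M1 ME.
pose bad n := (om n == i) && (c < 1 - cos (2 * pi * (orb w n).1)).
have badP n : bad n -> cnorm (char_fun k' p' a n) <= g.
  move=> /andP[/eqP oi hc]; rewrite le_max; apply/orP; right.
  have -> : p i j1 * p i j2 = p' n j1 * p' n j2 by rewrite /p' oi.
  apply: cnorm_char_fun_lt => //; rewrite ?/k' ?oi//.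
  rewrite (_ : a n j1 - a n j2 = 2 * pi * (orb w n).1) ?ltW//.
  rewrite /a /freq_phase lin_prod_cpow /orbit_pt oi /w /dt /cmul /csub /cconj /=.
  by ring.
have gb := cnorm_char_prod_blocks psum p0 L M (ltW g0) (ltW g1) badP.
apply: (@le_trans _ _ (g ^+ bad_count beta i L c om (clog lam) w M)).
  apply: (four _ (L * M)%N); first by rewrite exprn_ge0 ?(ltW g0).
  by move=> N LN; rewrite (le_trans (cnorm_char_prod_anti a psum p0 LN)).
(* At least [M / D] blocks are bad, hence at least [(M - N0) / D]. *)
rewrite gX ler_expR lerN2 mulrAC ler_pdivrMr// -mulrA ler_pM2l//.
rewrite (@le_trans _ _ M%:R)// ?gerBl//.
by rewrite -natrM ler_nat mulnC.
Qed.

End Decay.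

(** * The exceptional set *)

Section BoxMeasurability.
Context {R : realType}.

Lemma measurable_box (c : cplx R) r : measurable (box c r).
Proof.
have m1 (x : R) : measurable [set y : R | `|y - x| <= r].
  rewrite (_ : [set _ | _] = `[x - r, x + r]%classic); first exact: measurable_itv.
  by apply/seteqP; split => y /=; rewrite in_itv /= ler_distl.
rewrite (_ : box c r = [set y | `|y - c.1| <= r] `*` [set y | `|y - c.2| <= r]).
  exact: measurableX.
by apply/seteqP; split.
Qed.

Lemma measurable_boxes (cs : seq (cplx R)) r : measurable (boxes cs r).
Proof.
elim: cs => [|c cs IH].
  by rewrite (_ : boxes _ _ = set0)//; rewrite -subset0 => z [].
rewrite (_ : boxes (c :: cs) r = box c r `|` boxes cs r).
  by apply: measurableU => //; exact: measurable_box.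
apply/seteqP; split => z /=.
  by move=> [c']; rewrite inE => /orP[/eqP ->|cc] zc; [left|right; exists c'].
by move=> [zc|[c' cc zc]]; [exists c; rewrite ?mem_head|exists c'; rewrite // inE cc orbT].
Qed.

Lemma measurable_pdisc : measurable (@pdisc R).
Proof.
pose n2 (z : cplx R) : R := z.1 ^+ 2 + z.2 ^+ 2.
have mn : measurable_fun setT n2.
  have m1 : measurable_fun setT (fun z : cplx R => z.1) by exact: measurable_fst.
  have m2 : measurable_fun setT (fun z : cplx R => z.2) by exact: measurable_snd.
  by apply: measurable_funD; apply: measurable_funX.
rewrite (_ : @pdisc R = setT `&` n2 @^-1` `]0, 1[%classic).
  by apply: mn => //; exact: measurable_itv.
apply/seteqP; split => z /=; rewrite in_itv /= /n2 -cnorm_sqr.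
  move=> [z1]; rewrite -cnorm_gt0 => z0; split => //.
  by rewrite exprn_gt0//= exprn_ilt1// ltW.
move=> [_ /andP[z0 z1]]; split.
  by rewrite ltNge; apply/negP => /(exprn_ege1 2); rewrite leNgt z1.
rewrite -cnorm_gt0 lt_def cnorm_ge0 andbT.
by apply: contraL z0 => /eqP ->; rewrite expr0n ltxx.
Qed.

End BoxMeasurability.

Section Assembly.
Context {R : realType} {I : finType} {i0 : I}.

(** [cf_len f M] is the number of letters of [om] on which the [M]-th cover depends; recording it
    makes measurability in the pair immediate. *)
Record cover_family := CoverFamily {
  cf_centers : nat -> seq I -> seq (cplx R);
  cf_len : nat -> nat;
  cf_radius : nat -> R }.

Definition cf_boxes (f : cover_family) (M : nat) (om : nat -> I) : set (cplx R) :=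
  boxes (cf_centers f M (prefix_word om (cf_len f M))) (cf_radius f M).

Definition cf_limsup (f : cover_family) (om : nat -> I) : set (cplx R) :=
  \bigcap_n \bigcup_(M in [set M | (n <= M)%N]) cf_boxes f M om.

Definition cf_thin (f : cover_family) (om : nat -> I) : Prop :=
  exists C : R, 0 < C /\ exists N, forall M, (N <= M)%N ->
    [/\ 0 <= cf_radius f M, cf_radius f M <= C * 2^-1 ^+ M &
        (size (cf_centers f M (prefix_word om (cf_len f M))))%:R * cf_radius f M <= C].

Lemma cf_thin_null f om s : cf_thin f om -> 1 < s -> content_inf s (cf_limsup f om) = 0%E.
Proof.
by move=> [C [C0 [N hN]]] s1; exact: (@content_inf_limsup0 _ _ _ C s N s1 C0 hN).
Qed.

Lemma not_limsup f om z : ~ cf_limsup f om z ->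
  exists N, forall M, (N <= M)%N -> ~ cf_boxes f M om z.
Proof.
move=> h; apply: contrapT => h2; apply: h => n _; apply: contrapT => h3; apply: h2.
by exists n => M nM zM; apply: h3; exists M.
Qed.

(** Each cover is a finite union, over words, of a cylinder times a union of boxes. *)
Lemma measurable_cf_limsup f :
  measurable [set x : Omega i0 * cplx R | cf_limsup f x.1 x.2].
Proof.
have mb M : measurable [set x : Omega i0 * cplx R | cf_boxes f M x.1 x.2].
  set n := cf_len f M.
  rewrite (_ : [set _ | _] = \bigcup_(t in [set: n.-tuple I])
      ((cylinder i0 t : set (Omega i0)) `*` boxes (cf_centers f M t) (cf_radius f M))).
    apply: fin_bigcup_measurable => // t _; apply: measurableX.
      exact: measurable_cylinder.
    exact: measurable_boxes.
  apply/seteqP; split => [x /= hx|x [t _ [ht]]].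
    have sz : size (prefix_word x.1 n) == n by rewrite size_prefix_word.
    exists (Tuple sz) => //=; split => //=; rewrite cylinderE /= size_prefix_word.
    exact: erefl.
  by rewrite cylinderE size_tuple in ht; rewrite /= /cf_boxes -/n ht.
rewrite (_ : [set _ | _] = \bigcap_n \bigcup_(M in [set M | (n <= M)%N])
    [set x : Omega i0 * cplx R | cf_boxes f M x.1 x.2]).
  by apply: bigcap_measurableType => n _; apply: bigcup_measurable => M _; exact: mb.
by apply/seteqP; split.
Qed.

End Assembly.

Theorem theorem1p5 (R : realType) (I : finType) (i0 : I)
    (beta : I -> cplx R) (hbeta : forall i, beta i != (0, 0))
    (q : I -> R) (P : probability (Omega i0) R)
    (hP : bernoulli_measure q P) :
  exists G : set (Omega i0 * cplx R)%type,
    [/\ measurable G,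
        G `<=` [set: Omega i0] `*` @disc R,
        {ae P, forall om : Omega i0,
           (hausdorff_dim [set lam | @pdisc R lam /\ ~ G (om, lam)] <= 1%:E)%E}
      & forall (om : Omega i0) (lam : cplx R), G (om, lam) ->
          forall (k : I -> nat) (t : I -> nat -> cplx R) (p : I -> nat -> R),
            prob_vector k p ->
            model_nondegenerate P k t ->
            (forall i, cnorm (cpow lam (beta i)) < 1) ->
            eta_in_D2 om (fun i => cpow lam (beta i)) k t p].
Proof.
have [q0 q1 hq] := hP.
pose B := \sum_j cnorm (beta j).
have B0 : 0 <= B by apply: sumr_ge0 => j _; exact: cnorm_ge0.
have beta_le j : cnorm (beta j) <= B.
  by rewrite /B (bigD1 j)//= lerDl sumr_ge0// => *; exact: cnorm_ge0.
(* As [m] grows, [kap m] increases to 1 and [sg m] decreases to 0, so the regular regions exhaust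
   the contracting parameters with non-real [i]-th multiplier. *)
pose kap (m : nat) : R := 1 - (m%:R + 2)^-1.
pose sg (m : nat) : R := (m%:R + 1)^-1.
have m2 (m : nat) : 0 < m%:R + 2 :> R by rewrite ltr_wpDl.
have m1 (m : nat) : 0 < m%:R + 1 :> R by rewrite ltr_wpDl.
have kap0 m : 0 < kap m.
  by rewrite subr_gt0 invf_lt1// ltr_wpDl// ltr1n.
have kap1 m : kap m < 1 by rewrite ltrBlDr ltrDl invr_gt0.
have sg0 m : 0 < sg m by rewrite invr_gt0.
have sg1 m : sg m <= 1 by rewrite invf_le1// lerDr.
pose orb om lam w n := orbit_pt beta om (clog lam) w n.
(* The Boolean separates the two kinds of exceptional parameters: real [i]-th multiplier, or regular
   parameter with few bad blocks. *)
pose covers (x : nat * I * bool) (f : cover_family) : Prop :=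
  let: (m, i, curve) := x in
  if curve then forall om (lam : cplx R), lam != (0, 0) -> cnorm (clog lam) <= m%:R ->
    (cexp (cmul (beta i) (clog lam))).2 = 0 -> cf_limsup f om lam
  else 0 < q i -> exists (c : R) (L D : nat), [/\ 0 < c, (0 < L)%N, (0 < D)%N &
    forall om (lam : cplx R), lam != (0, 0) ->
      regular beta i m%:R (kap m) (sg m) (clog lam) -> ~ cf_limsup f om lam ->
      exists N0, forall M w, (N0 <= M)%N -> 1 <= cnorm (orb om lam w (L * M)) ->
        cnorm (orb om lam w (L * M)) <= expR (L%:R * B * m%:R) ->
        (M <= D * bad_count beta i L c om (clog lam) w M)%N].
have ex_cover x : exists f, {ae P, forall om : Omega i0, cf_thin f om} /\ covers x f.
  case: x => [[m i] [|]] /=.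
    have [cs [r [C [C0 hC hcov]]]] := curve_cover (hbeta i) (ler0n R m).
    exists (CoverFamily (fun M _ => cs M) (fun=> 0%N) r); split.
      by apply: aeW => om; exists C; split => //; exists 0%N.
    by move=> om lam lam0 lm lz n _; exists n => //=; exact: hcov.
  case: (ltP 0 (q i)) => [qi|qi]; last first.
    exists (CoverFamily (fun _ _ => [::]) (fun=> 0%N) (fun=> 0)); split => //.
    apply: aeW => om; exists 1; split => //; exists 0%N => M _ /=.
    by rewrite mulr0 mul1r exprn_ge0.
  have [cs [r [C [c [L [D [[C0 c0 L0 D0] hthin hbad]]]]]]] :=
    erdos_kahane hP qi (hbeta i) (ler0n R m) (kap0 m) (kap1 m) (sg0 m) (sg1 m) beta_le.
  exists (CoverFamily cs (fun M => L * M)%N r); split.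
    by apply: filterS hthin => om hN; exists C; split.
  (* The threshold depends on [lam] but not on [w], because the boxes catch [lam] as soon as one
     frequency fails. *)
  move=> _; exists c, L, D; split => // om lam lam0 reg /not_limsup[N hN].
  by exists N => M w NM h1 h2; apply: hbad => //; exact: hN.
have [F hF] := choice ex_cover.
pose G := [set x : Omega i0 * cplx R | pdisc x.2 /\ forall a, ~ cf_limsup (F a) x.1 x.2].
exists G; split.
- rewrite (_ : G = ([set: Omega i0] `*` @pdisc R) `&`
      ~` \bigcup_(n in [set: nat]) [set x | if unpickle n is Some a
          then cf_limsup (F a) x.1 x.2 else False]).
    apply: measurableI.
      by apply: measurableX => //; exact: measurable_pdisc.
    apply: measurableC; apply: bigcup_measurable => n _.
    case: (unpickle n) => [a|]; first exact: measurable_cf_limsup.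
    by rewrite (_ : [set _ | _] = set0).
  apply/seteqP; split => x /=.
    move=> [px h]; split; first by split.
    by move=> [n _] /=; case: unpickle => // a; exact: h.
  move=> [[_ px] h]; split => // a xa; apply: h; exists (pickle a) => //=.
  by rewrite pickleK.
- by move=> x [[px _] _]; split.
- have : {ae P, forall om : Omega i0, forall n,
      if unpickle n is Some a then cf_thin (F a) om else True}.
    apply: ae_foralln => n; case: (unpickle n) => [a|]; last exact: aeW.
    by have [] := hF a.
  apply: filterS => om thin; apply: hausdorff_dim_le1 => s s1.
  apply/eqP; rewrite eq_le content_inf_ge0 andbT.
  rewrite -(@content_inf_bigcup0 _ s (fun n =>
      if unpickle n is Some a then cf_limsup (F a) om else set0)); last first.
    move=> n; have := thin n; case: unpickle => [a /cf_thin_null|_]; first exact.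
    apply/eqP; rewrite eq_le content_inf_ge0 andbT.
    have := content_inf_boxes [::] (lexx (0 : R)) (lt_trans ltr01 s1).
    by rewrite mul0r; apply: le_trans; exact: le_content_inf.
  apply: le_content_inf => lam [plam /= nG].
  have [a ha] : exists a, cf_limsup (F a) om lam.
    apply: contrapT => h; apply: nG; split => // a ha; apply: h; by exists a.
  by exists (pickle a) => //=; rewrite pickleK.
move=> om lam [[_ lam0] hG] k t p hp [i [Pi [j1 [j2 [h1 h2 ht]]]]] hlt.
have qi : 0 < q i.
  move: Pi; rewrite (_ : [set _ | _] = (cylinder i0 [:: i] : set (Omega i0))).
    by rewrite hq big_seq1 lte_fin.
  by apply/seteqP; split => o /=; [rewrite cylinderE /prefix_word /= => ->|case].
set l := clog lam.
pose z j := cexp (cmul (beta j) l).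
have z1 j : cnorm (z j) < 1 by exact: hlt.
(* A real multiplier would place [lam] in a curve cover, against membership in [G]. *)
have zim : (z i).2 != 0.
  apply/eqP => zi0.
  have lb : cnorm l <= (Num.Def.archi_bound (cnorm l))%:R by rewrite ltW// archi_boundP// cnorm_ge0.
  apply: (hG (Num.Def.archi_bound (cnorm l), i, true)).
  by have [_] := hF (Num.Def.archi_bound (cnorm l), i, true); apply.
pose x j := (1 - cnorm (z j))^-1.
have x0 j : 0 < x j by rewrite invr_gt0 subr_gt0.
(* One integer above this sum meets the three conditions of [regular] simultaneously. *)
pose bd := cnorm l + \sum_j x j + `|(z i).2|^-1.
pose m := Num.Def.archi_bound bd.
have sx0 : 0 <= \sum_j x j by apply: sumr_ge0 => j _; exact: ltW.
have zi0 : 0 < `|(z i).2|^-1 by rewrite invr_gt0 normr_gt0.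
have nl := cnorm_ge0 l.
have mbd : bd < m%:R by apply: archi_boundP; rewrite !addr_ge0// ltW.
have lm : cnorm l <= m%:R by rewrite /bd in mbd; lra.
have zk j : cnorm (z j) <= kap m.
  have xj : x j <= \sum_j x j.
    by rewrite (bigD1 j)//= lerDl sumr_ge0// => j' _; exact: ltW.
  have : (m%:R + 2)^-1 <= (x j)^-1 by rewrite lef_pV2 ?posrE//; rewrite /bd in mbd; lra.
  by rewrite /x invrK /kap; lra.
have zs : sg m <= `|(z i).2|.
  by rewrite /sg -[leRHS]invrK lef_pV2 ?posrE//; rewrite /bd in mbd; lra.
have [_ /(_ qi)[c [L [D [c0 L0 D0 hcov]]]]] := hF (m, i, false).
have reg : regular beta i m%:R (kap m) (sg m) (clog lam) by split.
have [N0 hN0] := hcov om lam lam0 reg (hG _).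
exact: (eta_decay (ler0n R m) (kap0 m) (kap1 m) lm zk beta_le B0 L0 D0 c0 hN0 hp h1 h2 ht).
Qed.
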